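(* Let $\tilde{L}_B(z,x)=\sum_{n,k\ge 0} b_{n,k}\,\frac{x^k z^n}{k!}$, where $b_{n,k}$ is the number of isomorphism classes, up to free local exchange, of neutral linear lambda terms of size $n$ whose set of free variables is a fixed set of $k$ distinct variables. Then for all $n,k\ge 0$, the coefficient of $z^n x^k$ in $\tilde{L}_B(z,x)$ (i.e. $b_{n,k}/k!$) equals the number of isomorphism classes of rooted maps with $n$ edges and $k$ vertices on oriented surfaces of arbitrary genus.
   Context: Lambda terms are built from variables $x$, applications $t(u)$ and abstractions $\lambda x.t$, and are considered up to $\alpha$-equivalence. A term is linear if every variable, free or bound by a $\lambda$, occurs exactly once (so in $\lambda x.t$, $x$ occurs free in $t$ exactly once, and in $t(u)$ the free variables of $t$ and $u$ are disjoint). Neutral and normal terms are defined by mutual induction: (1) any variable is neutral; (2) if $t$ is neutral and $u$ is normal then $t(u)$ is neutral; (3) every neutral term is normal; (4) if $t$ is normal and $x$ is free in $t$ then $\lambda x.t$ is normal. The size of a neutral or normal term is the number of times rule (3) is invoked on subterms in its derivation; for a neutral linear term it equals its number of variable occurrences minus one. A term $t'$ is a local exchange of $t$ if it is obtained (up to $\alpha$-equivalence) by replacing a subterm $\lambda x.\lambda y.u$ of $t$ by $\lambda y.\lambda x.u$; two terms are isomorphic (up to free local exchange) if one is obtained from the other by a finite sequence of local exchanges (free variables are not renamed). A rooted map on an oriented surface is given by a finite set $D$ with two permutations $\sigma,\alpha$ of $D$ such that $\alpha$ is a fixed-point-free involution and $\langle\sigma,\alpha\rangle$ acts transitively on $D$,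 together with a root $r\in D$; two rooted maps are isomorphic if one is obtained from the other by conjugation along a bijection sending root to root. Its edges are the cycles of $\alpha$ and its vertices the cycles of $\sigma$. By convention there is exactly one rooted map with $0$ edges, and it has one vertex. *)

(* Defs.v *)
From Stdlib Require Import ClassicalEpsilon Relation_Operators.
From mathcomp Require Import all_boot all_order all_algebra all_fingroup.

Set Implicit Arguments.
Unset Strict Implicit.
Unset Printing Implicit Defensive.

Import GRing.Theory.
Local Open Scope nat_scope.

(* Lambda terms up to alpha-equivalence, as de Bruijn terms: under d
   abstractions, Var i is bound by the (i+1)-st enclosing abstraction, counted
   from the inside, when i < d, and is the free variable number i - d
   otherwise. *)
Inductive term : Type :=
| Var of nat
| App of term & term
| Lam of term.

(* The free variables of t, listed with one entry per occurrence.  In the body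
   of an abstraction, variable 0 is the bound one. *)
Fixpoint fv (t : term) : seq nat :=
  match t with
  | Var i => [:: i]
  | App t u => fv t ++ fv u
  | Lam t => [seq i.-1 | i <- fv t & 0 < i]
  end.

Fixpoint linear (t : term) : bool :=
  match t with
  | Var _ => true
  | App t u => [&& linear t, linear u & ~~ has (mem (fv t)) (fv u)]
  | Lam t => linear t && (count_mem 0 (fv t) == 1)
  end.

(* neutral t n (resp. normal t n): t is neutral (resp. normal), by a derivation
   that uses the rule normal_neutral exactly n times. *)
Inductive neutral : term -> nat -> Prop :=
| neutral_var i : neutral (Var i) 0
| neutral_app t u m n :
    neutral t m -> normal u n -> neutral (App t u) (m + n)
with normal : term -> nat -> Prop :=
| normal_neutral t n : neutral t n -> normal t n.+1
| normal_lam t n : normal t n -> 0 \in fv t -> normal (Lam t) n.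

Definition up (f : nat -> nat) (i : nat) : nat :=
  if i is j.+1 then (f j).+1 else 0.

Fixpoint rename (f : nat -> nat) (t : term) : term :=
  match t with
  | Var i => Var (f i)
  | App t u => App (rename f t) (rename f u)
  | Lam t => Lam (rename (up f) t)
  end.

Definition swap01 (i : nat) : nat :=
  match i with 0 => 1 | 1 => 0 | _ => i end.

(* In lambda x. lambda y. u, the body u sees y as variable 0 and x as variable
   1; reordering the two abstractions exchanges these two indices in u. *)
Inductive local_exchange : term -> term -> Prop :=
| exchange_here u :
    local_exchange (Lam (Lam u)) (Lam (Lam (rename swap01 u)))
| exchange_appl t t' u :
    local_exchange t t' -> local_exchange (App t u) (App t' u)
| exchange_appr t u u' :
    local_exchange u u' -> local_exchange (App t u) (App t u')
| exchange_lam t t' :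
    local_exchange t t' -> local_exchange (Lam t) (Lam t').

Definition term_iso : term -> term -> Prop := clos_refl_trans term local_exchange.

(* The fixed set of k free variables is {0, ..., k - 1}. *)
Definition neutral_linear (n k : nat) (t : term) : Prop :=
  [/\ neutral t n, linear t & forall i, (i \in fv t) = (i < k)].

(* Rooted maps with at least one edge. *)
Record dart_map : Type := DartMap {
  dart : finType;
  sigma : {perm dart};
  alpha : {perm dart};
  root : dart;
  alpha_involutive : involutive alpha;
  alpha_fixfree : forall d, alpha d != d;
  map_transitive :
    [transitive <<[set sigma; alpha]>>%g, on [set: dart] | 'P]
}.

Definition dart_map_iso (M N : dart_map) : Prop :=
  exists f : dart M -> dart N,
    [/\ bijective f,
        forall d, f (sigma M d) = sigma N (f d),
        forall d, f (alpha M d) = alpha N (f d)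
      & f (root M) = root N].

(* The map with one vertex and no edge has no dart to be rooted at, hence is
   added separately. *)
Inductive rooted_map : Type :=
| VertexMap
| OfDartMap of dart_map.

Definition nb_edges (M : rooted_map) : nat :=
  if M is OfDartMap M then #|porbits (alpha M)| else 0.

Definition nb_vertices (M : rooted_map) : nat :=
  if M is OfDartMap M then #|porbits (sigma M)| else 1.

Definition rooted_map_iso (M N : rooted_map) : Prop :=
  match M, N with
  | VertexMap, VertexMap => True
  | OfDartMap M, OfDartMap N => dart_map_iso M N
  | _, _ => False
  end.

Definition rooted_map_with (n k : nat) (M : rooted_map) : Prop :=
  nb_edges M = n /\ nb_vertices M = k.

(* For an equivalence relation E: the elements satisfying P fall into exactly m
   classes, of which r is a system of representatives. *)
Definition has_nb_classes (T : Type) (P : T -> Prop) (E : T -> T -> Prop)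
    (m : nat) : Prop :=
  exists r : 'I_m -> T,
    (forall i, P (r i)) /\ (forall x, P x -> exists! i, E x (r i)).

Definition finitely_many_classes (T : Type) (P : T -> Prop)
    (E : T -> T -> Prop) : Prop := exists m, has_nb_classes P E m.

(* Meaningful when finitely_many_classes P E holds. *)
Definition nb_classes (T : Type) (P : T -> Prop) (E : T -> T -> Prop) : nat :=
  epsilon (inhabits 0) (has_nb_classes P E).

Lemma has_nb_classes_le (T : Type) (P : T -> Prop) (E : T -> T -> Prop) m1 m2 :
  (forall x y, E x y -> E y x) -> (forall x y z, E x y -> E y z -> E x z) ->
  has_nb_classes P E m1 -> has_nb_classes P E m2 -> m1 <= m2.
Proof.
move=> Es Et [r1 [P1 u1]] [r2 [P2 u2]].
pose g i := proj1_sig (constructive_indefinite_description _ (u2 _ (P1 i))).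
have gE i : E (r1 i) (r2 (g i)).
  by rewrite /g; case: constructive_indefinite_description => j [].
have gI : injective g.
  move=> i j gij; have [l [_ ul]] := u1 _ (P2 (g i)).
  rewrite -(ul i (Es _ _ (gE i))); apply: ul.
  by rewrite gij; apply/Es/gE.
by have := leq_card g gI; rewrite !card_ord.
Qed.

Lemma nb_classesE (T : Type) (P : T -> Prop) (E : T -> T -> Prop) m :
  (forall x y, E x y -> E y x) -> (forall x y z, E x y -> E y z -> E x z) ->
  has_nb_classes P E m -> nb_classes P E = m.
Proof.
move=> Es Et Em; have E' : has_nb_classes P E (nb_classes P E).
  by apply: epsilon_spec; exists m.
by apply/eqP; rewrite eqn_leq (has_nb_classes_le Es Et E' Em)
  (has_nb_classes_le Es Et Em E').
Qed.

Definition b (n k : nat) : nat := nb_classes (neutral_linear n k) term_iso.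

(* A formal power series in z and x over the rationals, given by its
   coefficients: f n k is the coefficient of z^n x^k. *)
Definition bivariate_series : Type := nat -> nat -> rat.

Definition L_B : bivariate_series := fun n k => ((b n k)%:R / k`!%:R)%R.

(* Main.v *)
From HB Require Import structures.
From Stdlib Require Import ClassicalEpsilon Relation_Operators.
From mathcomp Require Import all_boot all_order all_algebra all_fingroup.
From mathcomp Require Import zify ring.
Require Import Defs.

(** Up to local exchange, only the set of leaves bound by a block of
    abstractions matters.  Hence the class of a neutral linear term is determined
    by its list of free variables, in order of occurrence, and by its skeleton,
    which has a mask of bound leaves in place of each block; b n k is k! times the
    number of skeletons with n applications and k free leaves.  If B_n is the sum
    of X^(number of free leaves) over the skeletons with n applications, then
    B_0 = X and B_(n+1) = sum_i B_i(X) B_(n-i)(X+1).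

    Let a_n = X (X+1) ... (X+2n-1) / (2^n n!).  Then (2n)! a_n is the sum of
    X^(number of cycles of sigma) over all pairs (sigma, alpha) on 2n labelled
    darts, transitive or not.  Isolating the component of the root shows that the
    sums C_n over the transitive pairs are determined by
      sum_(1 <= i <= n) C_i / (2i-1)! a_(n-i) = 2n a_n,
    and each rooted map with n edges has (2n-1)! labellings that fix the label of
    the root.  Finally sum_i B_i a_(n-i) = (X+2n) a_n, by induction on n from
    X a_n(X+1) = (X+2n) a_n, so that C_n = (2n-1)! B_n. *)

Set Implicit Arguments.
Unset Strict Implicit.
Unset Printing Implicit Defensive.

Import GRing.Theory Num.Theory.
Local Open Scope nat_scope.

(** * Local exchanges and renamings *)

Lemma eq_up f g : f =1 g -> up f =1 up g.
Proof. by move=> fg [|i] //=; rewrite fg. Qed.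

Lemma eq_rename f g t : f =1 g -> rename f t = rename g t.
Proof.
elim: t f g => [i|t IHt u IHu|t IHt] f g fg /=; first by rewrite fg.
- by rewrite (IHt f g) // (IHu f g).
- by rewrite (IHt (up f) (up g)) //; apply: eq_up.
Qed.

Lemma rename_comp f g t : rename f (rename g t) = rename (f \o g) t.
Proof.
elim: t f g => [i|t IHt u IHu|t IHt] f g //=; first by rewrite IHt IHu.
by rewrite IHt; congr Lam; apply: eq_rename => -[].
Qed.

Lemma rename_id f t : f =1 id -> rename f t = t.
Proof.
elim: t f => [i|t IHt u IHu|t IHt] f fE //=; first by rewrite fE.
- by rewrite IHt // IHu.
- by rewrite IHt // => -[|i] //=; rewrite fE.
Qed.

Lemma fv_rename f t : fv (rename f t) = map f (fv t).
Proof.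
elim: t f => [i|t IHt u IHu|t IHt] f //=; first by rewrite IHt IHu map_cat.
by rewrite IHt; elim: (fv t) => [|[|i] l IHl] //=; rewrite IHl.
Qed.

Lemma up_inj f : injective f -> injective (up f).
Proof. by move=> fI [|i] [|j] //= [] /fI ->. Qed.

Lemma linear_rename f t : injective f -> linear (rename f t) = linear t.
Proof.
elim: t f => [i|t IHt u IHu|t IHt] f fI //=.
- rewrite IHt // IHu // !fv_rename; do 2 congr andb; congr negb.
  rewrite has_map; apply: eq_has => i /=; exact: mem_map.
- rewrite IHt; last exact: up_inj.
  congr andb; rewrite fv_rename count_map; congr (_ == _).
  by apply: eq_count => -[].
Qed.

Scheme neutral_mind := Minimality for neutral Sort Prop
with normal_mind := Minimality for normal Sort Prop.
Combined Scheme neutral_normal_ind from neutral_mind, normal_mind.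

Lemma neutral_normal_rename :
  (forall t n, neutral t n -> forall f, neutral (rename f t) n) /\
  (forall t n, normal t n -> forall f, normal (rename f t) n).
Proof.
apply: neutral_normal_ind => [i|t u m n _ IHt _ IHu|t n _ IHt|t n _ IHt t0] f /=.
- exact: neutral_var.
- exact: neutral_app.
- exact: normal_neutral.
- apply: normal_lam; first exact: IHt.
  rewrite fv_rename; exact: (map_f (up f) t0).
Qed.

(** The counter [e] absorbs the leading abstractions. Once they are passed, an occurrence in the
    body is marked true when this block binds it; which abstraction of the block binds it is
    forgotten. *)
Fixpoint mask e t :=
  if t is Lam t' then mask e.+1 t' else [seq i < e | i <- fv t].

Lemma mask_rename f e t : (forall i, (f i < e) = (i < e)) ->
  mask e (rename f t) = mask e t.
Proof.
elim: t f e => [i|t IHt u IHu|t IHt] f e fe; first by rewrite /= fe.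
- transitivity [seq i < e | i <- fv (rename f (App t u))]; first by [].
  rewrite fv_rename -map_comp; exact: eq_map.
- by apply: (IHt (up f)) => -[|i] //=; rewrite !ltnS.
Qed.

Lemma swap01K : involutive swap01.
Proof. by case=> [|[|]]. Qed.

Lemma local_exchange_sym t u : local_exchange t u -> local_exchange u t.
Proof.
elim=> {t u} [u|t t' u _ IH|t u u' _ IH|t t' _ IH]; last 3 first.
- exact: exchange_appl.
- exact: exchange_appr.
- exact: exchange_lam.
have {2}-> : u = rename swap01 (rename swap01 u).
  by rewrite rename_comp rename_id //; apply: swap01K.
exact: exchange_here.
Qed.

Lemma term_iso_sym t u : term_iso t u -> term_iso u t.
Proof.
elim=> {t u} [t u tu|t|t u v _ ut _ vu].
- exact/rt_step/local_exchange_sym.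
- exact: rt_refl.
- exact: (rt_trans _ _ _ _ _ vu ut).
Qed.

Lemma term_iso_trans t u v : term_iso t u -> term_iso u v -> term_iso t v.
Proof. exact: rt_trans. Qed.

Lemma term_iso_map (c : term -> term) t u :
  (forall t u, local_exchange t u -> local_exchange (c t) (c u)) ->
  term_iso t u -> term_iso (c t) (c u).
Proof.
move=> cP; elim=> {t u} [t u tu|t|t u v _ ut _ vu].
- exact/rt_step/cP.
- exact: rt_refl.
- exact: (rt_trans _ _ _ _ _ ut vu).
Qed.

(** * Skeletons *)

(** [Node s u m] stands for an application: [s] comes from the function, [u] from the argument
    stripped of its leading abstractions, and [m] marks the leaves of [u] that these abstractions
    bind. *)
Inductive skeleton := Leaf | Node of skeleton & skeleton & bitseq.

Lemma skeleton_eq_dec (s s' : skeleton) : decidable (s = s').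
Proof. rewrite /decidable; do !decide equality. Qed.

HB.instance Definition _ :=
  hasDecEq.Build skeleton (compareP skeleton_eq_dec).

Fixpoint leaves s :=
  if s is Node s _ m then leaves s + count negb m else 1.

Fixpoint nodes s := if s is Node s u _ then (nodes s + nodes u).+1 else 0.

Fixpoint wf s :=
  if s is Node s u m then [&& wf s, wf u & size m == leaves u] else true.

(** Abstractions are skipped because a block in argument position is recorded by the mask of the
    application above it. *)
Fixpoint shape t :=
  match t with
  | Var _ => Leaf
  | App t u => Node (shape t) (shape u) (mask 0 u)
  | Lam t => shape t
  end.

Lemma shape_rename f t : shape (rename f t) = shape t.
Proof.
elim: t f => [i|t IHt u IHu|t IHt] f //=; by rewrite IHt IHu mask_rename.
Qed.

(** The masks are compared for every [e] because [mask] raises [e] when the induction goes under an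
    abstraction. *)
Lemma local_exchange_invariant t u : local_exchange t u ->
  [/\ shape t = shape u, fv t = fv u & forall e, mask e t = mask e u].
Proof.
elim=> {t u} [u|t t' u _ [s f m]|t u u' _ [s f m]|t t' _ [s f m]] /=.
- split=> [||e]; first by rewrite shape_rename.
  + by rewrite fv_rename; elim: (fv u) => [|[|[|i]] l IHl] //=; rewrite IHl.
  + by rewrite mask_rename // => -[|[|]].
- by split=> [||e]; rewrite ?s ?f.
- by split=> [||e]; rewrite ?s ?f ?m.
- by split=> [||e]; rewrite ?s ?f.
Qed.

Lemma term_iso_invariant t u : term_iso t u -> shape t = shape u /\ fv t = fv u.
Proof.
elim=> {t u} [t u /local_exchange_invariant[-> ->]|//|t u v _ [-> ->] _ [-> ->]];
by [].
Qed.

(** * Blocks of abstractions *)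

Definition lams j := iter j Lam.

Lemma fv_lams j t : fv (lams j t) = [seq i - j | i <- fv t & j <= i].
Proof.
elim: j => [|j IHj] /=.
  by rewrite (eq_map subn0) map_id; apply/esym/all_filterP/allP.
rewrite IHj; elim: (fv t) => //= i l IHl.
case: (ltngtP j i) => //= [ji|ji]; last by rewrite -ji subnn.
by rewrite subn_gt0 ji /= IHl subnS.
Qed.

Lemma linear_lams j t :
  linear (lams j t) = linear t && all (fun i => count_mem i (fv t) == 1) (iota 0 j).
Proof.
elim: j => [|j IHj]; first by rewrite andbT.
have -> : iota 0 j.+1 = iota 0 j ++ [:: j] by rewrite -addn1 iotaD.
rewrite /= IHj all_cat /= andbT andbA; congr (_ && (_ == _)).
rewrite fv_lams count_map count_filter; apply: eq_count => i /=.
by rewrite subn_eq0 eqn_leq.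
Qed.

Lemma mask_lams e j t : mask e (lams j t) = mask (j + e) t.
Proof. by elim: j e => //= j IHj e; rewrite IHj addnS. Qed.

Lemma shape_lams j t : shape (lams j t) = shape t.
Proof. by elim: j. Qed.

Lemma mask_neutral e t n : neutral t n -> mask e t = [seq i < e | i <- fv t].
Proof. by case. Qed.

Lemma normal_lams t n : normal t n ->
  exists j u m, [/\ t = lams j u, neutral u m & n = m.+1].
Proof.
elim: t n => [i|t IHt u IHu|t IHt] n tn; inversion tn as [t1 m1 H|t1 m1 H].
- by exists 0, (Var i), m1.
- by exists 0, (App t u), m1.
- by inversion H.
- have [j [u [m [-> um ->]]]] := IHt _ H.
  by exists j.+1, u, m.
Qed.

Lemma normal_lamsP j t n :
  neutral t n -> linear (lams j t) -> normal (lams j t) n.+1.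
Proof.
move=> tn; elim: j => [|j IHj] /=; first by move=> _; apply: normal_neutral.
case/andP=> /IHj tn' c1; apply: normal_lam => //.
by rewrite -has_pred1 has_count (eqP c1).
Qed.

Lemma size_fv_mask e t : size [seq i <- fv t | e <= i] = count negb (mask e t).
Proof.
elim: t e => [i|t _ u _|t IHt] e.
- by rewrite /= leqNgt; case: (i < e).
- rewrite size_filter count_map; apply: eq_count => i /=; exact: leqNgt.
- rewrite /= -IHt !size_filter count_map count_filter; apply: eq_count.
  by case=> [|i] /=; rewrite ?andbF ?andbT.
Qed.

(** Rule [normal_neutral] is used once for each argument of an application, hence once per node, and
    one more time at the top of a normal term. *)
Lemma neutral_normal_shape :
  (forall t n, neutral t n ->
    [/\ wf (shape t), nodes (shape t) = n & size (fv t) = leaves (shape t)]) /\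
  (forall t n, normal t n ->
    [/\ wf (shape t), (nodes (shape t)).+1 = n
      & forall e, size (mask e t) = leaves (shape t)]).
Proof.
apply: neutral_normal_ind =>
  [i|t u m n _ [wt nt lt] _ [wu nu lu]|t n tn [wt nt lt]|t n _ [wt nt lt] _] //=.
- rewrite wt wu lu eqxx nt -nu addnS size_cat lt -size_fv_mask.
  by split=> //; congr (_ + size _); apply/esym/all_filterP/allP.
- by rewrite nt; split=> // e; rewrite (mask_neutral _ tn) size_map.
Qed.

Lemma linear_uniq_fv t : linear t -> uniq (fv t).
Proof.
elim: t => //= [t IHt u IHu /and3P[/IHt Ut /IHu Uu Dtu]|t IHt /andP[/IHt Ut _]].
  by rewrite cat_uniq Ut Dtu Uu.
rewrite map_inj_in_uniq ?filter_uniq //.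
by move=> [|i] [|j]; rewrite !mem_filter //= => _ _ ->.
Qed.

(** * Neutral linear terms up to local exchange *)

Definition transp0 a i := if i == 0 then a else if i == a then 0 else i.

Lemma transp0K a : involutive (transp0 a).
Proof.
by move=> i; rewrite /transp0; do !case: eqP; lia.
Qed.

(* Every permutation of the indices below j is obtained from that fact for
   j - 1 and from the exchange of the two innermost abstractions: move f 0 to
   1, then to 0, and conclude on a permutation that fixes 0. *)
Lemma lams_rename j f t : injective f -> (forall i, j <= i -> f i = i) ->
  term_iso (lams j t) (lams j (rename f t)).
Proof.
have lamsSr k u : lams k.+1 u = lams k (Lam u) by rewrite /lams iterSr.
elim: j f t => [|j IHj] f t fI fj.
  by rewrite rename_id; [exact: rt_refl|move=> i; apply: fj].
(* A renaming that fixes [0] is [up] of a renaming of the outer indices, so it acts on [Lam u] under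
   only [j] abstractions. *)
have fix0 h u : injective h -> h 0 = 0 -> (forall i, j < i -> h i = i) ->
    term_iso (lams j.+1 u) (lams j.+1 (rename h u)).
  move=> hI h0 hj.
  have up_h : up (fun i => (h i.+1).-1) =1 h.
    case=> //= i; rewrite prednK // lt0n; apply/eqP => hi0.
    by have := hI _ 0; rewrite h0 => /(_ i.+1 hi0).
  rewrite !lamsSr -(eq_rename u up_h) -/(rename _ (Lam u)); apply: IHj.
    move=> i i' /= eqi; apply: succn_inj; apply: hI.
    by rewrite -[h i.+1]up_h -[h i'.+1]up_h /= eqi.
  by move=> i ji; rewrite hj.
case f0: (f 0) => [|a]; first exact: fix0.
have aj : a < j.
  rewrite ltnNge; apply/negP => ja.
  by have := fj a.+1 ja; rewrite -[in RHS]f0 => /fI.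
(* [g] fixes [0] and exchanges [1] with [f 0]. Hence [h] below fixes [0] as well, and [fix0] covers
   both [g] and [h]. *)
pose g := up (transp0 a).
have gI : injective g by apply: up_inj; apply: inv_inj; apply: transp0K.
have gj i : j < i -> g i = i.
  case: i => //= i ji; congr _.+1; rewrite /transp0.
  by case: eqP => [?|_]; last case: eqP => // ?; lia.
have gK : involutive g by case=> //= i; rewrite transp0K.
have swapI := inv_inj swap01K.
have j0 : 0 < j by lia.
pose h := swap01 \o g \o f.
have fE : f =1 g \o (swap01 \o h).
  by move=> i; rewrite /h /= swap01K gK.
have h0 : h 0 = 0 by rewrite /h /= f0 /= /transp0 eqxx; case: eqP => // ->.
have hj i : j < i -> h i = i.
  by move=> ji; rewrite /h /= fj // gj //; case: i ji => [|[|i]] //; lia.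
have step u : term_iso (lams j.+1 u) (lams j.+1 (rename swap01 u)).
  case: (j) j0 => // j' _; rewrite !lamsSr.
  elim: j' => [|j' IH]; first exact/rt_step/exchange_here.
  by apply: term_iso_map IH => *; apply: exchange_lam.
have -> : rename f t = rename g (rename swap01 (rename h t)).
  by rewrite !rename_comp; apply: eq_rename.
apply: term_iso_trans (fix0 h t _ h0 hj) _.
  by apply: inj_comp fI; apply: inj_comp swapI gI.
apply: term_iso_trans (step _) _.
exact: fix0.
Qed.

(** The first hypothesis fixes which positions hold free entries, the second fixes these entries in
    order, so a free entry stands at the same place in both lists. *)
Lemma bound_free_nth j l l' x : [seq i < j | i <- l] = [seq i < j | i <- l'] ->
  [seq i - j | i <- l & j <= i] = [seq i - j | i <- l' & j <= i] ->
  x \in l -> j <= x -> nth 0 l' (index x l) = x.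
Proof.
elim: l l' => [|y l IHl] [|y' l'] //= [by' bl].
rewrite (leqNgt j y) (leqNgt j y') -by'; case: ltnP => yj /=.
  move=> fl; rewrite inE => /predU1P[->|xl] jx; first by lia.
  by case: eqP => [yx|yx] /=; [lia|apply: IHl].
case=> yy' fl; rewrite inE => /predU1P[->|xl] jx; first by rewrite eqxx /=; lia.
by case: eqP => [yx|yx] /=; [lia|apply: IHl].
Qed.


Lemma linear_lams_count j t x : linear (lams j t) -> x < j -> x \in fv t.
Proof.
rewrite linear_lams => /andP[_ /allP] /(_ x); rewrite mem_iota add0n => xj /xj.
by rewrite -has_pred1 has_count => /eqP ->.
Qed.

(** Matching occurrences by position gives a permutation [f] of the [j] bound indices that carries
    [fv t] to [fv t']. By [lams_rename] it costs only local exchanges, and the first hypothesis,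
    which is the induction hypothesis of [linear_neutral_iso], applies to [rename f t]. *)
Lemma lams_linear_iso j t t' :
  (forall u, linear u -> shape u = shape t' -> fv u = fv t' ->
    (forall n, neutral t n -> neutral u n) -> term_iso u t') ->
  [seq i < j | i <- fv t] = [seq i < j | i <- fv t'] ->
  fv (lams j t) = fv (lams j t') -> shape t = shape t' ->
  linear (lams j t) -> linear (lams j t') ->
  term_iso (lams j t) (lams j t').
Proof.
move=> IH tt'; rewrite !fv_lams => ftt' st Lt Lt'.
have Ut : uniq (fv t) by move: Lt; rewrite linear_lams => /andP[/linear_uniq_fv].
have Ut' : uniq (fv t').
  by move: Lt'; rewrite linear_lams => /andP[/linear_uniq_fv].
have sz : size (fv t) = size (fv t') by have := congr1 size tt'; rewrite !size_map.
pose f i := if i < j then nth 0 (fv t') (index i (fv t)) else i.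
have fE i : i \in fv t -> f i = nth 0 (fv t') (index i (fv t)).
  rewrite /f; case: ltnP => // ji it.
  exact/esym/(bound_free_nth tt' ftt').
have flt i : i < j -> f i < j.
  move=> ij; have it := linear_lams_count Lt ij; rewrite fE //.
  have := congr1 (nth false ^~ (index i (fv t))) tt'.
  by rewrite !(nth_map 0) -?sz ?index_mem // nth_index // ij => <-.
have fge i : j <= i -> f i = i by rewrite /f ltnNge => ->.
have fI : injective f.
  move=> x y; case: (ltnP x j) (ltnP y j) => xj [] yj; last first.
  - by rewrite !fge.
  - by move=> fxy; have := flt _ yj; rewrite -fxy fge // ltnNge xj.
  - by move=> fxy; have := flt _ xj; rewrite fxy fge // ltnNge yj.
  have [xt yt] := (linear_lams_count Lt xj, linear_lams_count Lt yj).
  move/eqP; rewrite !fE // nth_uniq ?index_mem -?sz ?index_mem //.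
  by move/eqP/(congr1 (nth 0 (fv t))); rewrite !nth_index.
have ffv : map f (fv t) = fv t'.
  apply: (@eq_from_nth _ 0) => [|i]; rewrite size_map // => it.
  by rewrite (nth_map 0) // fE ?mem_nth // index_uniq.
apply: term_iso_trans (lams_rename t fI fge) _.
suff: term_iso (rename f t) t'.
  elim: (j) => //= j' IHj /IHj; apply: (term_iso_map (c := Lam)).
  exact: exchange_lam.
apply: IH; rewrite ?shape_rename ?fv_rename ?linear_rename //.
  by move: Lt; rewrite linear_lams => /andP[].
by move=> n tn; apply: neutral_normal_rename.1.
Qed.

(** By linearity each abstraction of the block binds exactly one leaf. The mask thus determines the
    length of the block. *)
Lemma count_mask_lams j t n : neutral t n -> linear (lams j t) ->
  count id (mask 0 (lams j t)) = j.
Proof.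
move=> tn L; rewrite mask_lams addn0 (mask_neutral _ tn) count_map.
rewrite (eq_count (a2 := fun i => i < j)) // -size_filter -[RHS](size_iota 0).
apply/perm_size/uniq_perm; rewrite ?iota_uniq ?filter_uniq //.
  by apply: linear_uniq_fv; move: L; rewrite linear_lams => /andP[].
move=> i; rewrite mem_filter mem_iota add0n /=; case: ltnP => //= ij.
exact: linear_lams_count L ij.
Qed.

(** Induction on the common skeleton. The functions are handled by the induction hypothesis; the
    arguments start with blocks of equal length, since their masks agree, and [lams_linear_iso]
    compares them. *)
Lemma linear_neutral_iso t n t' n' : neutral t n -> neutral t' n' ->
  linear t -> linear t' -> shape t = shape t' -> fv t = fv t' -> term_iso t t'.
Proof.
move sE: (shape t) => s.
elim: s t t' n n' sE => [|s1 IH1 s2 IH2 m] t t' n n' sE T T' Lt Lt' sE' ff.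
  inversion T; subst=> //; inversion T'; subst=> //.
  by case: ff => ->; apply: rt_refl.
inversion T as [|a u n1 m1 Na Nu]; subst=> //.
inversion T' as [|a' u' n1' m1' Na' Nu']; subst=> //.
have {}ff : fv a ++ fv u = fv a' ++ fv u' := ff.
case: sE => ? ? ?; subst s1 s2 m.
case: sE' Lt Lt' => [sa su mu] /= /and3P[La Lu _] /and3P[La' Lu' _].
have [[_ _ sza] [_ _ sza']] :=
  (neutral_normal_shape.1 _ _ Na, neutral_normal_shape.1 _ _ Na').
(* Both functions have as many free occurrences as their skeleton has leaves, so the two lists are
   cut at the same place. *)
move/eqP: ff; rewrite eqseq_cat; last by rewrite sza sza' sa.
case/andP=> /eqP fa /eqP fu.
have isoa : term_iso a a' by exact: (IH1 _ _ _ _ erefl Na Na' La La' sa fa).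
apply: (@term_iso_trans _ (App a' u)).
  by apply: (term_iso_map (c := App^~ u)) isoa => *; apply: exchange_appl.
apply: (term_iso_map (c := App a')) => [*|]; first exact: exchange_appr.
have [j [v [p [uE Nv _]]]] := normal_lams Nu.
have [j' [v' [p' [uE' Nv' _]]]] := normal_lams Nu'.
have jj' : j = j'.
  have := count_mask_lams (j := j) Nv; have := count_mask_lams (j := j') Nv'.
  by rewrite -uE -uE' mu => -> // ->.
subst j' u u'; move: su; rewrite !shape_lams => su.
apply: lams_linear_iso => // [w Lw sw fw Nw|].
  have Lv' : linear v' by move: Lu'; rewrite linear_lams => /andP[].
  by apply: IH2 (Nw _ Nv) Nv' Lw Lv' _ fw; rewrite ?shape_lams ?sw su.
by move: mu; rewrite !mask_lams addn0 (mask_neutral _ Nv) (mask_neutral _ Nv').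
Qed.

Lemma linear_neutral_isoP t n t' n' : neutral t n -> neutral t' n' ->
  linear t -> linear t' ->
  term_iso t t' <-> (shape t, fv t) = (shape t', fv t').
Proof.
move=> T T' Lt Lt'; split=> [/term_iso_invariant[-> ->]//|[]].
exact: linear_neutral_iso T T' Lt Lt'.
Qed.

(* Interleaves the bound variables i, ..., j - 1, at the positions marked true,
   with the free variables l, seen under j abstractions. *)
Fixpoint interleave j i (m : bitseq) l :=
  match m with
  | [::] => [::]
  | true :: m => i :: interleave j i.+1 m l
  | false :: m => j + head 0 l :: interleave j i m (behead l)
  end.

Lemma interleave_bound j i m l : i + count id m <= j ->
  [seq x < j | x <- interleave j i m l] = m.
Proof.
elim: m i l => [|[] m IHm] i l //= ij.
  by rewrite IHm; [congr (_ :: _)|]; lia.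
by rewrite ltnNge leq_addr IHm //; lia.
Qed.

Lemma interleave_lt j i m l : i + count id m <= j ->
  [seq x <- interleave j i m l | x < j] = iota i (count id m).
Proof.
elim: m i l => [|[] m IHm] i l //= ij.
  by rewrite ifT ?IHm //; lia.
by rewrite ltnNge leq_addr IHm //; lia.
Qed.

Lemma interleave_ge j i m l : i + count id m <= j -> size l = count negb m ->
  [seq x - j | x <- interleave j i m l & j <= x] = l.
Proof.
elim: m i l => [|[] m IHm] i l /=; first by case: l.
  by move=> ij sl; rewrite ifF ?IHm //; lia.
by case: l => //= x l ij [sl]; rewrite leq_addr /= addKn IHm.
Qed.

Lemma interleave_uniq j i m l : i + count id m <= j -> size l = count negb m ->
  uniq l -> uniq (interleave j i m l).
Proof.
move=> ij sl Ul; set s := interleave _ _ _ _.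
rewrite -(perm_uniq (permEl (perm_filterC (fun x => x < j) s))) cat_uniq.
rewrite interleave_lt // iota_uniq /=; apply/andP; split.
  apply/hasPn => x; rewrite mem_filter -/(predC _ x) /= => /andP[xj _].
  by apply: contra xj; rewrite mem_iota => /andP[_ /leq_trans]; apply.
apply: (@map_uniq _ _ (subn^~ j)).
rewrite (eq_filter (a2 := leq j)) ?interleave_ge // => x /=.
by rewrite -leqNgt.
Qed.

(** Induction on the skeleton. The list is cut after the leaves of the function; the rest,
    interleaved with the indices of the bound leaves in increasing order, is the list for the body
    of the argument. *)
Lemma shape_fv_surj s l : wf s -> size l = leaves s -> uniq l ->
  exists t, [/\ neutral t (nodes s), linear t, shape t = s & fv t = l].
Proof.
elim: s l => [|s1 IH1 s2 IH2 m] l /=.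
  by case: l => [|x []] // _ _ _; exists (Var x); split=> //; exact: neutral_var.
case/and3P=> wf1 wf2 /eqP sm sl; rewrite -(cat_take_drop (leaves s1) l).
set l1 := take _ _; set l2 := drop _ _; rewrite cat_uniq => /and3P[U1 l12 U2].
have [|t [Nt Lt St Ft]] := IH1 l1 wf1 _ U1.
  by rewrite size_takel // sl leq_addr.
have sl2 : size l2 = count negb m by rewrite size_drop sl addKn.
pose j := count id m; pose l' := interleave j 0 m l2.
have ij : 0 + count id m <= j by [].
have Ul' : uniq l' by apply: interleave_uniq.
have [|u [Nu Lu Su Fu]] := IH2 l' wf2 _ Ul'.
  by rewrite -sm -[in RHS](interleave_bound l2 ij) size_map.
have Fju : fv (lams j u) = l2 by rewrite fv_lams Fu interleave_ge.
have Lju : linear (lams j u).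
  rewrite linear_lams Lu; apply/allP => i ij'.
  rewrite Fu count_uniq_mem //; suff -> : i \in l' by [].
  have : i \in [seq x <- l' | x < j] by rewrite interleave_lt.
  by rewrite mem_filter => /andP[].
exists (App t (lams j u)); split=> /=.
- rewrite -addnS; apply: neutral_app => //; exact: normal_lamsP.
- by rewrite Lt Lju Ft Fju l12.
- rewrite St shape_lams Su mask_lams addn0 (mask_neutral _ Nu) Fu.
  by rewrite interleave_bound.
- by rewrite Ft Fju.
Qed.

(** Here [inv] is a complete invariant of the classes, which are counted through its values. *)
Lemma has_nb_classes_seq (I : eqType) (L : seq I) (T : Type) (P : T -> Prop)
    (E : T -> T -> Prop) (inv : T -> I) :
  uniq L -> (forall x, P x -> inv x \in L) ->
  (forall i, i \in L -> exists2 x, P x & inv x = i) ->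
  (forall x y, P x -> P y -> E x y <-> inv x = inv y) ->
  has_nb_classes P E (size L).
Proof.
move=> UL PL LP EP.
have /fin_all_exists[r rP] : forall i : 'I_(size L),
    exists x, P x /\ inv x = tnth (in_tuple L) i.
  by move=> i; have [x] := LP _ (mem_tnth i (in_tuple L)); exists x.
exists r; split=> [i|x Px]; first by case: (rP i).
have /tnthP[i xi] : inv x \in in_tuple L by apply: PL.
exists i; split=> [|i' Exi'].
  by apply/EP => //; have [] := rP i; rewrite // xi => _ ->.
have [Pi' ri'] := rP i'.
apply/val_inj/eqP; rewrite -(nth_uniq (inv x) (ltn_ord i) (ltn_ord i') UL).
by move: xi ri'; rewrite !(tnth_nth (inv x)) /= => <- <-; apply/eqP/EP.
Qed.

(** * Enumeration of the skeletons *)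

Fixpoint masks n : seq bitseq :=
  if n is n.+1 then map (cons true) (masks n) ++ map (cons false) (masks n)
  else [:: [::]].

Lemma mem_masks n m : (m \in masks n) = (size m == n).
Proof.
elim: n m => [|n IHn] [|c m] //=; rewrite mem_cat.
  by apply/norP; split; apply/negP => /mapP[].
rewrite eqSS -IHn; apply/orP/idP => [[] /mapP[m' mm' [_ ->]] //|mm].
by case: c; [left|right]; apply: map_f.
Qed.

Lemma masks_uniq n : uniq (masks n).
Proof.
elim: n => //= n IHn; rewrite cat_uniq !map_inj_uniq ?IHn; try by move=> ? ? [].
by rewrite andbT /=; apply/hasPn => _ /mapP[m _ ->]; apply/negP => /mapP[].
Qed.

(** The two parts of a skeleton share the remaining nodes in any proportion, so each level needs all
    earlier ones: [lv] lists them by number of nodes, starting from 0. *)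
Definition combine (lv : seq (seq skeleton)) : seq skeleton :=
  [seq Node p.1.1 p.1.2 p.2 |
     p <- [seq (q, m) |
       q <- [seq q | i <- iota 0 (size lv),
                     q <- [seq (s, u) | s <- nth [::] lv i,
                                        u <- nth [::] lv ((size lv).-1 - i)]],
       m <- masks (leaves q.2)]].

Fixpoint levels n :=
  if n is n.+1 then rcons (levels n) (combine (levels n)) else [:: [:: Leaf]].

Definition skeletons n := nth [::] (levels n) n.

Lemma size_levels n : size (levels n) = n.+1.
Proof. by elim: n => //= n IHn; rewrite size_rcons IHn. Qed.

Lemma nth_levels n i : i <= n -> nth [::] (levels n) i = skeletons i.
Proof.
elim: n => [|n IHn] /=; first by case: i.
rewrite nth_rcons size_levels; case: ltngtP => // [ni|->] _; first exact: IHn.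
by rewrite /skeletons /= nth_rcons size_levels eqxx ltnn.
Qed.

Definition node_args n : seq (skeleton * skeleton) :=
  [seq q | i <- iota 0 n.+1,
           q <- [seq (s, u) | s <- skeletons i, u <- skeletons (n - i)]].

Lemma skeletonsS n : skeletons n.+1 =
  [seq Node p.1.1 p.1.2 p.2 |
     p <- [seq (q, m) | q <- node_args n, m <- masks (leaves q.2)]].
Proof.
rewrite /skeletons /= nth_rcons size_levels eqxx ltnn /combine.
suff -> : [seq q | i <- iota 0 (size (levels n)),
    q <- [seq (s, u) | s <- nth [::] (levels n) i,
                       u <- nth [::] (levels n) ((size (levels n)).-1 - i)]] =
  node_args n by [].
rewrite size_levels; congr flatten; apply/eq_in_map => i.
by rewrite mem_iota => /andP[_ i_n]; rewrite !nth_levels ?leq_subr.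
Qed.

Lemma mem_skeletons n s : (s \in skeletons n) = wf s && (nodes s == n).
Proof.
elim/ltn_ind: n s => -[_ [|s u m]|n IHn s]; first by rewrite mem_seq1 eqxx.
  by rewrite mem_seq1 [RHS]andbC; apply/eqP.
rewrite skeletonsS; apply/mapP/idP => [[_ /allpairsPdep[q [m [qi mm ->]]] ->]|].
  case/allpairsPdep: qi mm => i [q' [i_n /allpairsP[[s1 s2] [/= s1i s2i q'E]] ->]].
  subst q' => /= mm.
  move: i_n; rewrite mem_iota ltnS => /andP[_ i_n].
  move: s1i s2i mm; rewrite !IHn ?ltnS ?leq_subr // mem_masks.
  move=> /andP[-> /eqP->] /andP[-> /eqP->] ->.
  by rewrite eqSS subnKC ?eqxx.
case: s => [|s1 s2 m] //=; rewrite eqSS => /andP[/and3P[w1 w2 sm] /eqP nE].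
subst n.
exists ((s1, s2), m) => //; apply/allpairsPdep; exists (s1, s2), m.
rewrite mem_masks sm; split=> //; apply/allpairsPdep.
exists (nodes s1), (s1, s2); rewrite mem_iota ltnS leq_addr addKn; split=> //.
by apply/allpairsP; exists (s1, s2); rewrite /= !IHn ?w1 ?w2 ?eqxx //; lia.
Qed.

Lemma skeletons_uniq n : uniq (skeletons n).
Proof.
elim/ltn_ind: n => -[//|n] IHn.
rewrite skeletonsS map_inj_uniq; last by move=> [[? ?] ?] [[? ?] ?] [-> -> ->].
apply: allpairs_uniq_dep => [||[? ?] [? ?] _ _ /= [-> ->] //]; last first.
  by move=> q _; apply: masks_uniq.
apply: allpairs_uniq_dep; first exact: iota_uniq.
  move=> i; rewrite mem_iota ltnS => /andP[_ i_n].
  apply: allpairs_uniq => [||[? ?] [? ?] _ _ [-> ->] //]; apply: IHn => //.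
  by rewrite ltnS leq_subr.
move=> _ _ /allpairsPdep[i [q [_ qi ->]]] /allpairsPdep[i' [q' [_ qi' ->]]] /= qq'.
(* The index is recovered as the number of nodes of the first part. *)
subst q'; suff -> : i = i' by [].
case/allpairsP: qi => -[s u] [/= si _ ->] in qi' *.
case/allpairsP: qi' => -[s' u'] [/= si' _ [ss' _]]; subst s'.
by move: si si'; rewrite !mem_skeletons => /andP[_ /eqP<-] /andP[_ /eqP<-].
Qed.

(** A class amounts to a skeleton with [k] free leaves and an order of the [k] variables along these
    leaves. *)
Lemma neutral_linear_nb_classes n k : has_nb_classes (neutral_linear n k) term_iso
  (count (fun s => leaves s == k) (skeletons n) * k`!).
Proof.
pose L := [seq (s, l) | s <- [seq s <- skeletons n | leaves s == k],
                        l <- permutations (iota 0 k)].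
have -> : count (fun s => leaves s == k) (skeletons n) * k`! = size L.
  by rewrite size_allpairs size_filter size_permutations ?iota_uniq // size_iota.
apply: (@has_nb_classes_seq _ L _ _ _ (fun t => (shape t, fv t))).
- apply: allpairs_uniq; rewrite ?filter_uniq ?skeletons_uniq ?permutations_uniq //.
  by move=> [? ?] [? ?] _ _ [-> ->].
- move=> t [Nt Lt ft]; have [w nd sz] := neutral_normal_shape.1 _ _ Nt.
  have pf : perm_eq (fv t) (iota 0 k).
    apply: uniq_perm; rewrite ?iota_uniq ?linear_uniq_fv // => i.
    by rewrite ft mem_iota.
  apply: allpairs_f; last by rewrite mem_permutations.
  by rewrite mem_filter -sz (perm_size pf) size_iota eqxx mem_skeletons w nd /=.
- move=> _ /allpairsP[[s l] [/= + + ->]].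
  rewrite mem_filter mem_skeletons mem_permutations.
  move=> /andP[/eqP lk /andP[w /eqP nd]] pl.
  have sl : size l = leaves s by rewrite (perm_size pl) size_iota.
  have [|t [Nt Lt st ft]] := shape_fv_surj w sl.
    by rewrite (perm_uniq pl) iota_uniq.
  exists t; last by rewrite st ft.
  by split=> [||i]; rewrite -?nd // ft (perm_mem pl) mem_iota.
- move=> t t' [Nt Lt _] [Nt' Lt' _]; exact: linear_neutral_isoP Nt Nt' Lt Lt'.
Qed.

(** * The skeleton polynomials *)

Local Open Scope ring_scope.

(** The polynomial B_n of the header. *)
Definition skel_poly (n : nat) : {poly rat} :=
  \sum_(s <- skeletons n) 'X^(leaves s).

Lemma coef_skel_poly n k :
  (skel_poly n)`_k = (count (fun s => leaves s == k) (skeletons n))%:R.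
Proof.
rewrite coef_sum -sum1_count natr_sum [RHS]big_mkcond; apply: eq_bigr => s _.
by rewrite coefXn eq_sym; case: eqP.
Qed.

Lemma sum_masks (R : comNzRingType) (x : R) n :
  \sum_(m <- masks n) x ^+ count negb m = (1 + x) ^+ n.
Proof.
elim: n => [|n IHn] /=; first by rewrite big_seq1 !expr0.
rewrite big_cat !big_map /= IHn exprS mulrDl mul1r -IHn mulr_sumr.
by congr (_ + _); apply: eq_bigr => m _; rewrite add1n exprS.
Qed.

Lemma skel_poly0 : skel_poly 0 = 'X.
Proof. by rewrite /skel_poly /skeletons /= big_seq1 expr1. Qed.

(** Each leaf of the argument is either bound, with weight 1, or still free, with weight X. Summing
    over the masks therefore substitutes X + 1 for X in the factor of the argument. *)
Lemma skel_polyS n : skel_poly n.+1 =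
  \sum_(i < n.+1) skel_poly i * (skel_poly (n - i) \Po ('X + 1)).
Proof.
rewrite {1}/skel_poly skeletonsS big_map big_allpairs_dep /=.
rewrite big_allpairs_dep /= -(big_mkord xpredT
  (fun i => skel_poly i * (skel_poly (n - i) \Po ('X + 1)))).
rewrite /index_iota subn0; apply: eq_bigr => i _.
rewrite big_allpairs_dep /= mulr_suml; apply: eq_bigr => s _.
rewrite raddf_sum mulr_sumr; apply: eq_bigr => u _ /=.
rewrite rmorphXn /= comp_polyX [in RHS]addrC -sum_masks mulr_sumr.
by apply: eq_bigr => m _; rewrite exprD.
Qed.

(** * Rising factorials and the convolution identity *)

Definition rising (N : nat) : {poly rat} := \prod_(i < N) ('X + i%:R).

Lemma risingS N : rising N.+1 = rising N * ('X + N%:R).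
Proof. by rewrite /rising big_ord_recr. Qed.

Lemma comp_natr (k : nat) (p : {poly rat}) : k%:R \Po p = k%:R.
Proof. by rewrite rmorph_nat. Qed.

Lemma rising_shift N : 'X * (rising N \Po ('X + 1)) = rising N.+1.
Proof.
rewrite /rising rmorph_prod big_ord_recl addr0; congr (_ * _).
apply: eq_bigr => i _; rewrite /= comp_polyD comp_polyX comp_natr.
by rewrite -addrA nat1r.
Qed.

(** The number of perfect matchings of [N] points: a given point has [N - 1] possible partners, and
    the other [N - 2] points are matched among themselves. *)
Fixpoint matchings N : nat :=
  match N with
  | 0 => 1
  | 1 => 0
  | (N'.+1 as M).+1 => (M * matchings N')%N
  end.

(* The polynomial a_n of the header. *)
Definition pair_coef n : {poly rat} := (2 ^ n * n`!)%:R^-1 *: rising n.*2.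

Lemma pair_coef_shift n :
  'X * (pair_coef n \Po ('X + 1)) = ('X + n.*2%:R) * pair_coef n.
Proof.
by rewrite /pair_coef comp_polyZ -!scalerAr rising_shift risingS mulrC.
Qed.

Lemma natr_mul_scaleV m c (p : {poly rat}) : (0 < m)%N ->
  m%:R * ((m * c)%:R^-1 *: p) = c%:R^-1 *: p.
Proof.
move=> m0; rewrite mulr_natl -scaler_nat scalerA natrM invfM mulrA.
by rewrite mulfV ?mul1r // pnatr_eq0 -lt0n.
Qed.

(** Two shifts append the factors X + 2n and X + 2n + 1 to the rising factorial, which leads from
    a_n to a_(n+1) in the induction of [skel_poly_conv]. *)
Lemma pair_coef_shift2 n :
  'X * (('X * (pair_coef n \Po ('X + 1))) \Po ('X + 1)) =
  n.+1.*2%:R * pair_coef n.+1.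
Proof.
rewrite pair_coef_shift comp_polyM comp_polyD comp_polyX comp_natr mulrCA.
rewrite pair_coef_shift /pair_coef doubleS !risingS.
have -> : (2 ^ n.+1 * n.+1`! = n.+1.*2 * (2 ^ n * n`!))%N.
  by rewrite expnS factS -mul2n; ring.
rewrite natr_mul_scaleV //.
rewrite -!scalerAr; congr (_ *: _).
by rewrite -[n.*2.+1]addn1 natrD; ring.
Qed.

(** Both sides are the coefficient of degree [n] in a product of three generating polynomials.
    Truncating these after degree [n] does not change it. *)
Lemma convolutionCA (R : comNzRingType) (f g h : nat -> R) n :
  \sum_(i < n.+1) (\sum_(j < i.+1) f j * g (i - j)%N) * h (n - i)%N =
  \sum_(i < n.+1) (\sum_(j < i.+1) f j * h (i - j)%N) * g (n - i)%N.
Proof.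
pose P (u : nat -> R) := \poly_(i < n.+1) u i.
have conv u v i : (i < n.+1)%N ->
    (P u * P v)`_i = \sum_(j < i.+1) u j * v (i - j)%N.
  move=> i_n; rewrite coefM; apply: eq_bigr => j _; rewrite !coef_poly.
  by rewrite !ifT //; have := ltn_ord j; lia.
have conv3 u v w : (P u * P v * P w)`_n =
    \sum_(i < n.+1) (\sum_(j < i.+1) u j * v (i - j)%N) * w (n - i)%N.
  rewrite coefM; apply: eq_bigr => i _; rewrite conv // coef_poly ifT //.
  by have := ltn_ord i; lia.
by rewrite -!conv3 mulrAC.
Qed.

(** For n + 1, the term i = 0 is X a_(n+1). In the others B_(i+1) is expanded and [convolutionCA]
    brings B and a together, so that the induction hypothesis yields (X+2i) a_i = X a_i(X+1). What
    remains is X times the shift of the identity for n, that is 2(n+1) a_(n+1). *)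
Lemma skel_poly_conv n : \sum_(i < n.+1) skel_poly i * pair_coef (n - i) =
  ('X + n.*2%:R) * pair_coef n.
Proof.
elim/ltn_ind: n => -[_|n IHn].
  by rewrite big_ord1 skel_poly0 subnn addr0.
rewrite big_ord_recl subn0 skel_poly0 mulrDl; congr (_ + _).
under eq_bigr do rewrite skel_polyS subSS.
rewrite (convolutionCA skel_poly (fun i => skel_poly i \Po ('X + 1)) pair_coef).
rewrite -pair_coef_shift2 pair_coef_shift -(IHn n) // raddf_sum mulr_sumr.
rewrite [RHS](reindex_inj rev_ord_inj); apply: eq_bigr => i _ /=.
rewrite IHn; last exact: ltn_ord.
have i_n : (i <= n)%N by rewrite -ltnS.
by rewrite -pair_coef_shift comp_polyM subSS (subKn i_n) -mulrA [X in 'X * X]mulrC.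
Qed.

(** The weighted count of all pairs on [N] labelled points, as [sum_pairs] shows. *)
Definition pair_poly N : {poly rat} := (matchings N)%:R * rising N.

Lemma matchingsSS N : matchings N.+2 = (N.+1 * matchings N)%N.
Proof. by []. Qed.

Lemma matchings_double n : (matchings n.*2 * (2 ^ n * n`!) = n.*2`!)%N.
Proof.
elim: n => // n IHn; rewrite doubleS matchingsSS !factS -IHn expnS.
by rewrite -!muln2; ring.
Qed.

Lemma matchings_odd n : matchings n.*2.+1 = 0%N.
Proof. by elim: n => // n IHn; rewrite doubleS matchingsSS IHn muln0. Qed.

Lemma pair_poly_double n : pair_poly n.*2 = n.*2`!%:R * pair_coef n.
Proof.
rewrite /pair_poly /pair_coef -matchings_double natrM -mulrA.
congr (_ * _); rewrite -[X in X%:R^-1]muln1 natr_mul_scaleV ?invr1 ?scale1r //.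
by rewrite muln_gt0 expn_gt0 fact_gt0.
Qed.

Lemma pair_poly_odd n : pair_poly n.*2.+1 = 0.
Proof. by rewrite /pair_poly matchings_odd mul0r. Qed.

(* The index is shifted: conn_poly N is for N + 1 points. *)
Definition conn_poly N : {poly rat} :=
  if odd N then N`!%:R * skel_poly N.+1./2 else 0.

Lemma sum_double (V : nmodType) (F : nat -> V) n :
  \sum_(i < n.*2) F i = \sum_(i < n) (F i.*2 + F i.*2.+1).
Proof.
elim: n => [|n IHn]; first by rewrite !big_ord0.
by rewrite doubleS !big_ord_recr /= IHn addrA.
Qed.

(** This has the form of the recursion on the component of a marked point, where [M] counts the
    other points of the component. For odd [N] it is [skel_poly_conv] times [N!], the binomial
    coefficients absorbing the factorials; for even [N] both sides vanish. *)
Lemma pair_poly_rec N : pair_poly N.+1 =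
  \sum_(M < N.+1) 'C(N, M)%:R * (conn_poly M * pair_poly (N - M)).
Proof.
case: (boolP (odd N)) => oN; last first.
  have [n ->] : exists n, N = n.*2 by exists N./2; rewrite even_halfK.
  rewrite pair_poly_odd big1 // => M _; rewrite /conn_poly.
  case: (boolP (odd M)) => oM; last by rewrite mul0r mulr0.
  have -> : (n.*2 - M = (n - M./2).-1.*2.+1)%N by have := ltn_ord M; lia.
  by rewrite pair_poly_odd !mulr0.
have [n ->] : exists n, N = n.*2.+1 by exists N./2; lia.
rewrite -doubleS (sum_double (fun M : nat => 'C(n.*2.+1, M)%:R *
  (conn_poly M * pair_poly (n.*2.+1 - M)))).
rewrite pair_poly_double doubleS factS natrM -doubleS.
have := skel_poly_conv n.+1; rewrite big_ord_recl subn0 skel_poly0 mulrDl.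
move/addrI => conv.
rewrite mulrAC -conv mulr_suml; apply: eq_bigr => i _.
rewrite /conn_poly /= /bump add1n odd_double /= mul0r mulr0 add0r subSS.
have -> : (n.*2.+1 - i.*2.+1 = (n - i).*2)%N by lia.
rewrite pair_poly_double.
have in_ : (i.*2.+1 <= n.*2.+1)%N by have := ltn_ord i; lia.
rewrite -(bin_fact in_); have -> : (n.*2.+1 - i.*2.+1 = (n - i).*2)%N by lia.
by rewrite doubleK; move: (i.*2.+1)`! => c; rewrite !natrM; ring.
Qed.

Local Open Scope nat_scope.

(** * Components of a pair of permutations *)

Section Pairs.
Variable D : finType.
Implicit Types (S O : {set D}) (s t : {perm D}) (p q : {perm D} * {perm D}).

Lemma perm_glue_l O O' s t x : perm_on O s -> perm_on O' t ->
  [disjoint O & O'] -> x \in O -> (s * t)%g x = s x.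
Proof.
move=> sO tO' OO' xO.
by rewrite permM (out_perm tO') // (disjointFr OO') // perm_closed.
Qed.

Lemma perm_glue_r O O' s t x : perm_on O s ->
  [disjoint O & O'] -> x \in O' -> (s * t)%g x = t x.
Proof.
by move=> sO OO' xO'; rewrite permM (out_perm sO) // (disjointFl OO').
Qed.

Lemma perm_on_glue O O' s t : perm_on O s -> perm_on O' t ->
  perm_on (O :|: O') (s * t)%g.
Proof.
by move=> sO tO'; apply: perm_onM;
  [apply: subset_trans sO _|apply: subset_trans tO' _];
  rewrite ?subsetUl ?subsetUr.
Qed.

Lemma perm_expn_on O s i x : perm_on O s -> x \in O -> (s ^+ i)%g x \in O.
Proof.
move=> sO xO; elim: i => [|i IH]; first by rewrite expg0 perm1.
by rewrite expgSr permM perm_closed.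
Qed.

Lemma porbit_sub O s x : perm_on O s -> x \in O -> porbit s x \subset O.
Proof.
by move=> sO xO; apply/subsetP => y /porbitP[i ->]; apply: perm_expn_on.
Qed.

Lemma eq_porbit_on O s t x : perm_on O s -> {in O, t =1 s} -> x \in O ->
  porbit t x = porbit s x.
Proof.
move=> sO ts xO.
have E i : (t ^+ i)%g x = (s ^+ i)%g x.
  elim: i => [|i IH]; first by rewrite !expg0.
  by rewrite !expgSr !permM IH ts // perm_expn_on.
by apply/setP => y; apply/porbitP/porbitP => -[i ->]; exists i; rewrite E.
Qed.

(** A permutation of a subset [S] is encoded as a permutation of [D] supported in [S]. Starting the
    orbits in [S] leaves out the fixed points outside. *)
Definition cyc S s := #|porbit s @: S|.

Lemma cyc_glue O O' s t : perm_on O s -> perm_on O' t -> [disjoint O & O'] ->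
  cyc (O :|: O') (s * t)%g = cyc O s + cyc O' t.
Proof.
move=> sO tO' OO'; rewrite /cyc imsetU.
have -> : porbit (s * t)%g @: O = porbit s @: O.
  apply: eq_in_imset => x xO; apply: (eq_porbit_on sO) => // y yO.
  exact: (perm_glue_l sO tO').
have -> : porbit (s * t)%g @: O' = porbit t @: O'.
  apply: eq_in_imset => x xO; apply: (eq_porbit_on tO') => // y yO.
  exact: (perm_glue_r t sO OO').
rewrite cardsU -[RHS]subn0; congr (_ - _); apply/eqP.
rewrite cards_eq0 -subset0; apply/subsetP => _ /setIP[/imsetP[x xO ->]].
case/imsetP=> y yO' xy; have := porbit_id s x; rewrite xy.
by move/(subsetP (porbit_sub tO' yO')); rewrite (disjointFr OO' xO).
Qed.

Lemma cyc1 S : cyc S 1%g = #|S|.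
Proof.
apply: card_imset => x y /setP/(_ x); rewrite porbit_id => /esym/porbitP[i ->].
by rewrite expg1n perm1.
Qed.

(** Here [s] is glued with the identity of the complement, each point of which is a cycle of its
    own. *)
Lemma card_porbits_cyc S s : perm_on S s -> #|porbits s| = cyc S s + #|~: S|.
Proof.
move=> sS; rewrite -cyc1 -cyc_glue ?perm_on1 //; last first.
  by rewrite disjoints_subset setCK.
rewrite setUCr mulg1; congr #|pred_of_set _|; apply/setP => A.
by apply/imsetP/imsetP => -[x _ ->]; exists x.
Qed.

Lemma perm_on_tperm S a b : a \in S -> b \in S -> perm_on S (tperm a b).
Proof.
move=> aS bS; apply: subset_trans (tperm_on a b) _.
by apply/subsetP => x; rewrite !inE => /orP[] /eqP->.
Qed.

(** The product inserts [a] just after [b] in the cycle of [b], unless [b = a]: then [a] is a new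
    cycle. *)
Lemma cyc_tperm S a b t : a \notin S -> b \in a |: S -> perm_on S t ->
  cyc (a |: S) (tperm a b * t)%g = (b == a) + cyc S t.
Proof.
move=> aS bS tS.
have tS' : perm_on (a |: S) t by apply: subset_trans tS _; apply: subsetUr.
have hS : perm_on (a |: S) (tperm a b * t)%g.
  by apply: perm_onM tS'; rewrite perm_on_tperm ?setU11.
have := porbits_mul_tperm t a b.
have -> : (a \notin porbit t b) = (a != b).
  congr negb; apply/idP/eqP => [|->]; last exact: porbit_id.
  rewrite porbit_sym => /porbitP[i ->].
  elim: i => [|i IH]; first by rewrite expg0 perm1.
  by rewrite expgSr permM -IH (out_perm tS).
rewrite /= (card_porbits_cyc hS) (card_porbits_cyc tS).
have := cardsC S; have := cardsC (a |: S); rewrite cardsU1 aS /= eq_sym.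
by case: eqP => _ /=; lia.
Qed.

Lemma perm_onU1 S a s : a \notin S ->
  perm_on S s = perm_on (a |: S) s && (s a == a).
Proof.
move=> aS; apply/idP/andP => [sS|[/subsetP sS /eqP sa]].
  by split; [apply: subset_trans sS _; apply: subsetUr|rewrite (out_perm sS)].
apply/subsetP => x xs; have := sS x xs; rewrite !inE => /predU1P[xa|//].
by rewrite inE xa sa eqxx in xs.
Qed.

Local Open Scope ring_scope.

(** The generating function of the Stirling numbers of the first kind. Removing a point [a] from its
    cycle leaves a permutation of the others together with the preimage [b] of [a]; [b = a] has
    weight X and each other choice weight 1. *)
Lemma sum_cyc S : \sum_(s | perm_on S s) 'X^(cyc S s) = rising #|S|.
Proof.
move: {2}#|S| (erefl #|S|) => N; elim: N S => [|N IHN] S SN.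
  move/eqP: SN; rewrite cards_eq0 => /eqP ->; rewrite cards0 /rising big_ord0.
  rewrite (big_pred1 1%g) => [|s].
    by rewrite cyc1 cards0 expr0.
  apply/idP/eqP => [s0|->]; last exact: perm_on1.
  by apply/permP => x; rewrite perm1 (out_perm s0) ?inE.
have [a aS] : exists a, a \in S by apply/card_gt0P; rewrite SN.
have SE : S = a |: (S :\ a) by rewrite setD1K.
have aS' : a \notin S :\ a by rewrite setD11.
have S'N : #|S :\ a| = N by move: SN; rewrite (cardsD1 a) aS => -[].
move: {aS} (S :\ a) SE aS' S'N => S' SE aS' S'N; rewrite {}SE in SN *.
rewrite (reindex_onto (fun q : D * {perm D} => (tperm a q.1 * q.2)%g)
  (fun s => (s^-1 a, tperm a (s^-1 a) * s)%g)) /=; last first.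
  by move=> s _; rewrite mulgA tperm2 mul1g.
rewrite (eq_bigl (fun q : D * {perm D} =>
  (q.1 \in a |: S') && perm_on S' q.2)); last first.
  case=> b t; apply/andP/andP => /= [[hS /eqP[hb ht]]|[bS tS]].
    have bS : b \in a |: S' by rewrite -hb perm_closed ?setU11 // perm_onV.
    split=> //; rewrite (perm_onU1 t aS'); apply/andP; split.
      rewrite -[t](mulKg (tperm a b)) tpermV perm_onM //.
      by rewrite perm_on_tperm ?setU11.
    by rewrite -[X in t X](tpermR a b) -permM -{2}hb permKV.
  have bS' : perm_on (a |: S') (tperm a b) by rewrite perm_on_tperm ?setU11.
  have tS' : perm_on (a |: S') t by apply: subset_trans tS _; apply: subsetUr.
  have E : ((tperm a b * t)^-1)%g a = b.
    by apply/(canLR (permK _)); rewrite permM tpermR (out_perm tS).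
  split; first exact: perm_onM.
  by apply/eqP; rewrite E mulgA tperm2 mul1g.
rewrite -(pair_big (mem (a |: S')) (perm_on S')
  (fun (b : D) t => 'X^(cyc (a |: S') (tperm a b * t)%g))) /=.
under eq_bigr => b bS.
  under eq_bigr => t tS do rewrite (cyc_tperm aS' bS tS) exprD.
  rewrite -mulr_sumr (IHN _ S'N).
  over.
rewrite -mulr_suml SN S'N risingS mulrC; congr (_ * _).
rewrite big_setU1 //= eqxx expr1; congr (_ + _).
rewrite (eq_bigr (fun _ => 1)) ?sumr_const ?S'N // => b bS.
by rewrite (negPf (memPn aS' b bS)).
Qed.
Local Close Scope ring_scope.

(** * Fixed-point-free involutions *)

Definition fpf_invol S := [set a : {perm D} |
  perm_on S a && [forall x in S, (a (a x) == x) && (a x != x)]].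

Lemma fpf_involP S t : reflect
  (perm_on S t /\ {in S, forall x, t (t x) = x /\ t x != x}) (t \in fpf_invol S).
Proof.
rewrite inE; apply: (iffP andP) => -[tS H]; split=> //.
  by move=> x xS; have /forall_inP/(_ x xS)/andP[/eqP] := H.
by apply/forall_inP => x xS; have [-> ->] := H x xS; rewrite eqxx.
Qed.

(** Multiplying by [tperm a b] adds the pair of [a] and [b] to an involution of the other points;
    [tperm_fpf_invol] removes it again. *)
Lemma fpf_invol_tperm S a b t : a \in S -> b \in S -> b != a ->
  (tperm a b * t)%g \in fpf_invol (S :\ a :\ b) ->
  t \in fpf_invol S /\ t a = b.
Proof.
move=> aS bS ba; set u := (_ * t)%g => /fpf_involP[uS uI].
have tE : t = (tperm a b * u)%g by rewrite mulgA tperm2 mul1g.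
have ua : u a = a by rewrite (out_perm uS) // !inE eqxx andbF.
have ub : u b = b by rewrite (out_perm uS) // !inE eqxx.
have ta : t a = b by rewrite tE permM tpermL.
have tb : t b = a by rewrite tE permM tpermR.
have tx x : x != a -> x != b -> t x = u x.
  by move=> xa xb; rewrite tE permM tpermD // eq_sym.
split=> //; apply/fpf_involP; split.
  rewrite tE perm_onM ?perm_on_tperm //.
  by apply: subset_trans uS _; rewrite !subDset !subsetU ?subxx ?orbT.
move=> x xS; case: (eqVneq x a) => [->|xa]; first by rewrite ta tb.
case: (eqVneq x b) => [->|xb]; first by rewrite tb ta eq_sym.
have xS' : x \in S :\ a :\ b by rewrite !inE xa xb.
have [ux1 ux2] := uI _ xS'; rewrite (tx x) //.
have : u x \in S :\ a :\ b by rewrite perm_closed.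
by rewrite !inE => /and3P[uxb uxa _]; rewrite tx.
Qed.

Lemma tperm_fpf_invol S a t : a \in S -> t \in fpf_invol S ->
  (tperm a (t a) * t)%g \in fpf_invol (S :\ a :\ t a).
Proof.
move=> aS /fpf_involP[tS tI]; have [tta ta] := tI a aS.
have ux x : x \in S :\ a :\ t a -> (tperm a (t a) * t)%g x = t x.
  by rewrite !inE => /and3P[xta xa _]; rewrite permM tpermD // eq_sym.
have tS' x : x \in S :\ a :\ t a -> t x \in S :\ a :\ t a.
  rewrite !inE (inj_eq perm_inj) (perm_closed _ tS) => /and3P[xta -> ->].
  by rewrite andbT /= -{1}tta (inj_eq perm_inj).
apply/fpf_involP; split.
  apply/subsetP => x; rewrite !inE permM; case: tpermP => [->|->|xa xta].
  - by rewrite tta eqxx.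
  - by rewrite eqxx.
  - move=> txx; rewrite (introF eqP xa) (introF eqP xta) /=.
    by apply: contraR txx => xS; rewrite (out_perm tS).
move=> x xS; rewrite !ux //; last exact: tS'.
by apply: tI; move: xS; rewrite !inE => /and3P[].
Qed.

(** The involutions are sorted by the partner [b] of a chosen point [a]. *)
Lemma card_fpf_invol S : #|fpf_invol S| = matchings #|S|.
Proof.
move: {2}#|S| (erefl #|S|) => N; elim/ltn_ind: N S => N IHN S SN.
case: (posnP #|S|) => [S0|].
  rewrite S0; apply/eqP/cards1P; exists 1%g; apply/setP => t; rewrite inE.
  apply/fpf_involP/eqP => [[tS _]|->].
    apply/permP => x; rewrite perm1 (out_perm tS) //.
    by rewrite (cards0_eq S0) inE.
  by split=> [|x]; rewrite ?perm_on1 // (cards0_eq S0) inE.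
case/card_gt0P=> a aS.
have fibre b : b \in S :\ a ->
    #|[set t in fpf_invol S | t a == b]| = matchings (N - 2).
  rewrite !inE => /andP[ba bS].
  rewrite -(card_imset _ (mulgI (tperm a b))).
  have S2 : #|S :\ a :\ b| = N - 2.
    have := cardsD1 a S; have := cardsD1 b (S :\ a); rewrite !inE ba aS bS /=.
    lia.
  rewrite -S2 -(IHN (N - 2)) //; last first.
    by have := cardsD1 a S; rewrite aS; lia.
  congr #|pred_of_set _|; apply/setP => u; apply/imsetP/idP => [[t]|uS].
    by rewrite inE => /andP[tI /eqP tab] ->; rewrite -tab tperm_fpf_invol.
  exists (tperm a b * u)%g; last by rewrite mulgA tperm2 mul1g.
  have [|uI uab] := @fpf_invol_tperm S a b (tperm a b * u)%g aS bS ba.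
    by rewrite mulgA tperm2 mul1g.
  by rewrite inE uI uab /=.
rewrite -[LHS]sum1_card (partition_big (fun t : {perm D} => t a)
  (mem (S :\ a))) /=; last first.
  move=> t /fpf_involP[tS tI]; have [_ ta] := tI a aS.
  by rewrite !inE ta perm_closed.
rewrite (eq_bigr (fun _ => matchings (N - 2))); last first.
  move=> b bS; rewrite -(fibre b bS) -sum1_card.
  by apply: eq_bigl => t; rewrite inE.
rewrite sum_nat_const; have := cardsD1 a S; rewrite aS SN add1n => ->.
by case: #|S :\ a| => [|m] //; rewrite subn2.
Qed.

Definition pairs S := [set p | perm_on S p.1 & p.2 \in fpf_invol S].

Lemma in_pairs S p :
  (p \in pairs S) = perm_on S p.1 && (p.2 \in fpf_invol S).
Proof. by rewrite in_set. Qed.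

Lemma sum_pairs S : (\sum_(p in pairs S) 'X^(cyc S p.1) = pair_poly #|S|)%R.
Proof.
rewrite (eq_bigl (fun p => perm_on S p.1 && (p.2 \in fpf_invol S))); last first.
  by move=> p; rewrite inE.
rewrite -(pair_big (perm_on S) (mem (fpf_invol S)) (fun s _ => 'X^(cyc S s)))%R /=.
rewrite exchange_big /= sum_cyc sumr_const card_fpf_invol.
by rewrite /pair_poly mulr_natl.
Qed.

Definition component p r := orbit 'P <<[set p.1; p.2]>>%g r.

Lemma component_id p r : r \in component p r.
Proof. exact: orbit_refl. Qed.

Lemma component_closed p r x : x \in component p r ->
  p.1 x \in component p r /\ p.2 x \in component p r.
Proof.
move=> xr; have E s : s \in [set p.1; p.2] -> s x \in component p r.
  move=> sp; case/orbitP: xr => g gG <-; apply/orbitP; exists (g * s)%g.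
    exact: groupM gG (mem_gen sp).
  by rewrite /= /aperm permM.
by split; apply: E; rewrite !inE eqxx ?orbT.
Qed.

(** The induction principle for components: closure under the two generators suffices. *)
Lemma component_min p r O : r \in O ->
  {in O, forall x, p.1 x \in O /\ p.2 x \in O} -> component p r \subset O.
Proof.
move=> rO Ocl; rewrite /component acts_sub_orbit //.
rewrite gen_subG; apply/subsetP => s; rewrite !inE => sp; apply/subsetP => x xO.
by rewrite inE /= /aperm; case/orP: sp => /eqP->; have [] := Ocl x xO.
Qed.

Definition conn_pairs S r := [set p in pairs S | component p r == S].

Lemma in_conn_pairs S r p :
  (p \in conn_pairs S r) = (p \in pairs S) && (component p r == S).
Proof. by rewrite in_set. Qed.

Lemma pairs_closed S p x : p \in pairs S -> x \in S -> p.1 x \in S /\ p.2 x \in S.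
Proof.
by rewrite inE => /andP[sS /fpf_involP[aS _]] xS; rewrite !perm_closed.
Qed.

Lemma component_eq p q O r : {in O, forall x, p.1 x = q.1 x /\ p.2 x = q.2 x} ->
  component q r = O -> component p r = O.
Proof.
move=> pq qO; have rO : r \in O by rewrite -qO component_id.
have pO : component p r \subset O.
  apply: component_min => // x xO; have [-> ->] := pq x xO.
  by rewrite -qO in xO *; apply: component_closed.
apply/eqP; rewrite eqEsubset pO -{1}qO component_min ?component_id // => x xp.
have [<- <-] := pq x (subsetP pO x xp); exact: component_closed.
Qed.

Lemma restr_perm_out O s x : x \notin O -> restr_perm O s x = x.
Proof. by move=> xO; rewrite (out_perm (restr_perm_on O s)). Qed.

Lemma stable_astabs O s : {in O, forall x, s x \in O} -> s \in 'N(O | 'P)%g.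
Proof.
move=> sO; rewrite !inE /=; apply/subsetP => x xO.
by rewrite inE /= /aperm sO.
Qed.

Lemma stableC S O s : perm_on S s -> {in O, forall x, s x \in O} ->
  {in S :\: O, forall x, s x \in S :\: O}.
Proof.
move=> sS /stable_astabs sO x; rewrite !inE (perm_closed _ sS).
by have := astabs_act x sO; rewrite /= /aperm => ->.
Qed.

Lemma fpf_invol_restr S O t : t \in fpf_invol S -> O \subset S ->
  {in O, forall x, t x \in O} -> restr_perm O t \in fpf_invol O.
Proof.
move=> /fpf_involP[_ tI] OS tO; apply/fpf_involP; split.
  exact: restr_perm_on.
move=> x xO; rewrite !restr_permE ?stable_astabs ?tO //.
exact/tI/(subsetP OS).
Qed.

Lemma glue_restr S O s : perm_on S s -> O \subset S -> {in O, forall x, s x \in O} ->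
  (restr_perm O s * restr_perm (S :\: O) s)%g = s.
Proof.
move=> sS OS sO; apply/permP => x; rewrite permM.
case: (boolP (x \in O)) => xO.
  by rewrite (restr_permE (stable_astabs sO) xO) restr_perm_out // inE sO.
rewrite (restr_perm_out _ xO); case: (boolP (x \in S)) => xS.
  by rewrite (restr_permE (stable_astabs (stableC sS sO))) // inE xO xS.
by rewrite restr_perm_out ?(out_perm sS) // inE (negPf xS) andbF.
Qed.

Lemma restr_glue_l O O' s t : perm_on O s -> perm_on O' t ->
  [disjoint O & O'] -> restr_perm O (s * t) = s.
Proof.
move=> sO tO' OO'; apply/permP => x; case: (boolP (x \in O)) => xO.
  rewrite restr_permE ?(perm_glue_l sO tO') //; apply: stable_astabs => y yO.
  by rewrite (perm_glue_l sO tO') // perm_closed.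
by rewrite restr_perm_out // (out_perm sO).
Qed.

Lemma restr_glue_r O O' s t : perm_on O s -> perm_on O' t ->
  [disjoint O & O'] -> restr_perm O' (s * t) = t.
Proof.
move=> sO tO' OO'; apply/permP => x; case: (boolP (x \in O')) => xO.
  rewrite restr_permE ?(perm_glue_r _ sO OO') //; apply: stable_astabs => y yO.
  by rewrite (perm_glue_r _ sO OO') // perm_closed.
by rewrite restr_perm_out // (out_perm tO').
Qed.

Lemma fpf_invol_glue O O' s t : s \in fpf_invol O -> t \in fpf_invol O' ->
  [disjoint O & O'] -> (s * t)%g \in fpf_invol (O :|: O').
Proof.
move=> /fpf_involP[sO sI] /fpf_involP[tO' tI] OO'; apply/fpf_involP; split.
  exact: perm_on_glue.
move=> x /setUP[] xO.
  by rewrite !(perm_glue_l sO tO') ?perm_closed //; apply: sI.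
by rewrite !(perm_glue_r _ sO OO') ?perm_closed //; apply: tI.
Qed.

Local Open Scope ring_scope.

(** A pair is cut into a transitive pair on the component [O] of [r] and an arbitrary pair on the
    rest. Gluing is the inverse operation, and numbers of cycles add up. *)
Lemma sum_pairs_component S r : r \in S ->
  \sum_(p in pairs S) 'X^(cyc S p.1) =
  \sum_(O : {set D} | (r \in O) && (O \subset S))
    (\sum_(p in conn_pairs O r) 'X^(cyc O p.1)) * pair_poly #|S :\: O| :> {poly rat}.
Proof.
move=> rS; rewrite (partition_big (component^~ r)
  (fun O => (r \in O) && (O \subset S))) /=; last first.
  move=> p pS; rewrite component_id component_min // => x; exact: pairs_closed.
apply: eq_bigr => O /andP[rO OS]; rewrite -sum_pairs big_distrlr /= pair_big /=.
have dO : [disjoint O & S :\: O] by rewrite -setI_eq0 setDE setICA setICr setI0.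
have uO : O :|: (S :\: O) = S by rewrite -[RHS](setID S O) (setIidPr OS).
rewrite (reindex_onto
  (fun q : ({perm D} * {perm D}) * ({perm D} * {perm D}) =>
     (q.1.1 * q.2.1, q.1.2 * q.2.2)%g)
  (fun p => ((restr_perm O p.1, restr_perm O p.2),
             (restr_perm (S :\: O) p.1, restr_perm (S :\: O) p.2)))) /=; last first.
  move=> p /andP[pS /eqP pO].
  have cl x : x \in O -> p.1 x \in O /\ p.2 x \in O.
    by rewrite -pO; apply: component_closed.
  move: pS; rewrite in_pairs => /andP[sS /fpf_involP[aS _]].
  rewrite !glue_restr //; try by move=> x /cl[].
  by case: (p).
rewrite (eq_bigl (fun q : ({perm D} * {perm D}) * ({perm D} * {perm D}) =>
  (q.1 \in conn_pairs O r) && (q.2 \in pairs (S :\: O)))).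
  apply: eq_bigr => -[[s a] [s' a']] /=; rewrite in_conn_pairs !in_pairs /=.
  move=> /andP[/andP[/andP[sO _] _] /andP[s'O _]].
  by rewrite -exprD -(cyc_glue sO s'O dO) uO.
move=> [[s a] [s' a']] /=; apply/idP/idP.
  (* The four equations say that each permutation is a restriction of the glued one, which gives its
     support. *)
  move=> /andP[/andP[pS /eqP pO] /eqP[E1 E2 E3 E4]].
  have cl x : x \in O -> (s * s')%g x \in O /\ (a * a')%g x \in O.
    by rewrite -pO; apply: component_closed.
  have cl1 : {in O, forall x, (s * s')%g x \in O} by move=> x /cl[].
  have cl2 : {in O, forall x, (a * a')%g x \in O} by move=> x /cl[].
  move: pS; rewrite in_pairs /= => /andP[sS aS].
  have [aS' _] := fpf_involP _ _ aS.
  have sO : perm_on O s by rewrite -E1 restr_perm_on.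
  have s'O : perm_on (S :\: O) s' by rewrite -E3 restr_perm_on.
  have aO : a \in fpf_invol O by rewrite -E2 (fpf_invol_restr aS).
  have a'O : a' \in fpf_invol (S :\: O).
    by rewrite -E4 (fpf_invol_restr aS) ?subsetDl //; apply: stableC.
  rewrite in_conn_pairs !in_pairs /= sO s'O aO a'O /= andbT; apply/eqP.
  apply: component_eq pO => x xO /=.
  by rewrite -{1}E1 -{1}E2 !restr_permE ?stable_astabs.
rewrite in_conn_pairs !in_pairs /=.
move=> /andP[/andP[/andP[sO aO] /eqP cO] /andP[s'O a'O]].
have [aO1 _] := fpf_involP _ _ aO; have [a'O1 _] := fpf_involP _ _ a'O.
have -> : perm_on S (s * s')%g by rewrite -uO perm_on_glue.
have -> : (a * a')%g \in fpf_invol S by rewrite -uO (fpf_invol_glue aO a'O dO).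
rewrite /=.
rewrite !(restr_glue_l _ _ dO) // !(restr_glue_r _ _ dO) // eqxx andbT.
apply/eqP/(component_eq _ cO) => x xO /=.
by rewrite (perm_glue_l sO s'O) // (perm_glue_l aO1 a'O1).
Qed.

(** Removing [r] from [O] leaves an arbitrary subset of the other points, and [M] is its size. *)
Lemma sum_subsets (F : nat -> {poly rat}) S r : r \in S ->
  \sum_(O : {set D} | (r \in O) && (O \subset S)) F #|O| =
  \sum_(M < #|S|) 'C(#|S|.-1, M)%:R * F M.+1.
Proof.
move=> rS; have S1 : #|S|.-1 = #|S :\ r| by rewrite (cardsD1 r) rS.
have -> : #|S| = #|S :\ r|.+1 by rewrite -S1 prednK // (cardD1 r) rS.
rewrite [_.+1.-1]/=; set S' := S :\ r.
rewrite (reindex_onto (fun A => r |: A) (fun O => O :\ r)); last first.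
  by move=> O /andP[rO _]; rewrite setD1K.
rewrite (eq_bigl (fun A : {set D} => A \subset S')); last first.
  move=> A; rewrite setU11 /= subUset sub1set rS /= subsetD1; congr andb.
  apply/eqP/idP => [<-|rA]; first by rewrite setD11.
  by rewrite setU1K.
rewrite (eq_bigr (fun A : {set D} => F #|A|.+1)); last first.
  by move=> A; rewrite subsetD1 => /andP[_ rA]; rewrite cardsU1 rA.
(* For a subset of [S'] the cardinal is in range, so [inord] preserves it. *)
rewrite (partition_big (fun A : {set D} => inord #|A| : 'I_(#|S'|.+1)) xpredT) //=.
apply: eq_bigr => M _.
rewrite -(cards_draws S' M) mulr_natl -sumr_const.
apply: eq_big => [A|A /andP[AS /eqP <-]].
  rewrite inE; case: (boolP (A \subset S')) => //= AS.
  by rewrite -val_eqE /= inordK // ltnS subset_leq_card.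
by rewrite inordK // ltnS subset_leq_card.
Qed.

(** Both sides solve the same recursion. By induction the terms for proper subsets [O] agree, and
    the term for [O = S], whose cofactor is [pair_poly 0 = 1], remains. *)
Lemma sum_conn_pairs S r : r \in S ->
  \sum_(p in conn_pairs S r) 'X^(cyc S p.1) = conn_poly #|S|.-1.
Proof.
move: {2}#|S| (erefl #|S|) => N; elim/ltn_ind: N S => N IHN S SN rS.
have S0 : #|S| = #|S|.-1.+1 by rewrite prednK // (cardD1 r) rS.
have cardD (O : {set D}) : O \subset S -> #|S :\: O| = (#|S| - #|O|)%N.
  by move=> OS; rewrite cardsD (setIidPr OS).
have pair0 : pair_poly 0 = 1 by rewrite /pair_poly /rising big_ord0 mulr1.
have rec : pair_poly #|S| = \sum_(O : {set D} | (r \in O) && (O \subset S))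
    conn_poly #|O|.-1 * pair_poly (#|S| - #|O|).
  rewrite (sum_subsets (fun m => conn_poly m.-1 * pair_poly (#|S| - m)) rS).
  rewrite [in LHS]S0 pair_poly_rec -S0; apply: eq_bigr => M _.
  by have -> : (#|S|.-1 - M = #|S| - M.+1)%N by lia.
have := sum_pairs S; rewrite (sum_pairs_component rS) rec.
rewrite (bigD1 S) ?rS //= [in RHS](bigD1 S) ?rS //=.
rewrite setDv cards0 subnn pair0 !mulr1.
rewrite [X in _ + X](eq_bigr (fun O : {set D} =>
  conn_poly #|O|.-1 * pair_poly (#|S| - #|O|))); first by move/addIr.
move=> O /andP[/andP[rO OS] ONS]; rewrite cardD // (IHN #|O|) //.
by rewrite -SN proper_card // properEneq ONS.
Qed.
End Pairs.

(** * Counting isomorphism classes *)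

Section Classes.
Variables (T : Type) (X : finType) (P : T -> Prop) (E : T -> T -> Prop) (f : X -> T).

Definition class_of t : {set X} :=
  [set x | excluded_middle_informative (E t (f x))].

Lemma in_class_of t x : reflect (E t (f x)) (x \in class_of t).
Proof. by rewrite inE; case: excluded_middle_informative => H; constructor. Qed.

(** Double counting: the classes partition the labels [X] into parts of size [c]. The set
    [class_of t] serves as the complete invariant. *)
Lemma has_nb_classes_uniform c :
  (forall x, E x x) ->
  (forall x y, E x y -> E y x) -> (forall x y z, E x y -> E y z -> E x z) ->
  (forall x, P (f x)) -> (forall t, P t -> exists x, E t (f x)) ->
  (forall x, #|class_of (f x)| = c) ->
  exists2 m, has_nb_classes P E m & m * c = #|X|.
Proof.
move=> Er Es Et Pf fP fc.
have classE t u : E t u -> class_of t = class_of u.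
  move=> tu; apply/setP => x; apply/in_class_of/in_class_of; apply: Et => //.
  exact: Es.
pose L := [set class_of (f x) | x : X].
exists #|L|.
  rewrite cardE; apply: (@has_nb_classes_seq _ _ _ _ _ class_of).
  - exact: enum_uniq.
  - move=> t /fP[x /classE->]; rewrite mem_enum; exact: imset_f.
  - move=> A; rewrite mem_enum => /imsetP[x _ ->]; by exists (f x).
  - move=> t u Pt Pu; split=> [/classE//|tu].
    have [x ux] := fP _ Pu; apply: (Et _ (f x)); last exact: Es.
    by apply/in_class_of; rewrite tu; apply/in_class_of.
rewrite -[RHS]sum1_card (partition_big_imset (fun x => class_of (f x))) /=.
rewrite -sum_nat_const; apply: eq_bigr => _ /imsetP[x _ ->].
rewrite -(fc x) -sum1_card; apply: eq_bigl => y.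
apply/in_class_of/eqP => [/Es /classE //|yx].
by apply/in_class_of; rewrite -yx; apply/in_class_of.
Qed.
End Classes.

(** * Isomorphisms of rooted maps *)

Lemma rooted_map_iso_refl M : rooted_map_iso M M.
Proof. by case: M => //= M; exists id; split=> //; exists id. Qed.

Lemma rooted_map_iso_sym M N : rooted_map_iso M N -> rooted_map_iso N M.
Proof.
case: M N => [|M] [|N] //= [f [[g fK gK] fs fa fr]].
exists g; split; first by exists f.
- by move=> d; rewrite -{1}[d]gK -fs fK.
- by move=> d; rewrite -{1}[d]gK -fa fK.
- by rewrite -fr fK.
Qed.

Lemma rooted_map_iso_trans M N K :
  rooted_map_iso M N -> rooted_map_iso N K -> rooted_map_iso M K.
Proof.
case: M N K => [|M] [|N] [|K] //= [f [fb fs fa fr]] [g [gb gs ga gr]].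
exists (g \o f); split; first exact: bij_comp.
- by move=> d /=; rewrite fs gs.
- by move=> d /=; rewrite fa ga.
- by rewrite /= fr.
Qed.

Lemma card_fpf_porbits (D : finType) (a : {perm D}) :
  involutive a -> (forall d, a d != d) -> #|D| = #|porbits a|.*2.
Proof.
move=> aK aF.
have orb x : porbit a x = [set x; a x].
  apply/setP => y; rewrite !inE; apply/porbitP/orP => [[i ->]|[]/eqP->].
  - elim: i => [|i IH]; first by rewrite expg0 perm1 eqxx; left.
    by rewrite expgSr permM; case: IH => /eqP->; rewrite ?aK eqxx; [right|left].
  - by exists 0; rewrite expg0 perm1.
  - by exists 1; rewrite expg1.
have -> : porbits a = porbit a @: D by [].
rewrite -[LHS]sum1_card (partition_big_imset (porbit a)) /=.
rewrite (eq_bigr (fun _ => 2)) ?sum_nat_const ?muln2 // => _ /imsetP[x _ ->].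
have -> : 2 = #|porbit a x| by rewrite orb cards2 eq_sym aF.
rewrite -sum1_card; apply: eq_bigl => y.
by rewrite eq_porbit_mem.
Qed.

Lemma card_porbits_conj (D D' : finType) (f : D -> D')
    (s : {perm D}) (s' : {perm D'}) : bijective f ->
  (forall d, f (s d) = s' (f d)) -> #|porbits s| = #|porbits s'|.
Proof.
move=> [g fK gK] fs.
have fsn i d : f ((s ^+ i)%g d) = (s' ^+ i)%g (f d).
  elim: i => [|i IH]; first by rewrite !expg0 !perm1.
  by rewrite !expgSr !permM fs IH.
have orb d : porbit s' (f d) = f @: porbit s d.
  apply/setP => y; apply/porbitP/imsetP => [[i ->]|[_ /porbitP[i ->] ->]].
    by exists ((s ^+ i)%g d); rewrite ?fsn // mem_porbit.
  by exists i; rewrite fsn.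
have -> : porbits s' = (fun A : {set D} => f @: A) @: porbits s.
  apply/setP => A; apply/imsetP/imsetP => [[d' _ ->]|[_ /imsetP[d _ ->] ->]].
    exists (porbit s (g d')); first exact: imset_f.
    by rewrite -orb gK.
  by exists (f d); rewrite ?orb.
by rewrite card_imset //; apply/imset_inj/(can_inj fK).
Qed.

Lemma transitive_component (D : finType) (p : {perm D} * {perm D}) r :
  [transitive <<[set p.1; p.2]>>%g, on [set: D] | 'P] <->
  component p r = [set: D].
Proof.
split=> [tr|cr]; first exact: (atransP tr).
by apply/imsetP; exists r.
Qed.

Lemma perm_onT (D : finType) (s : {perm D}) : perm_on [set: D] s.
Proof. by apply/subsetP => x _; rewrite inE. Qed.

(** * Maps with labelled darts, rooted at [ord0] *)

Section Labelled.
Variables N k : nat.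
Notation I := 'I_N.+1.

Definition labelled (p : {perm I} * {perm I}) :=
  (p \in conn_pairs setT ord0) && (cyc setT p.1 == k).

Lemma labelledP (p : {perm I} * {perm I}) : reflect
  [/\ involutive p.2, forall d, p.2 d != d, component p ord0 = [set: I]
    & #|porbits p.1| = k] (labelled p).
Proof.
have -> : #|porbits p.1| = cyc setT p.1.
  by rewrite (@card_porbits_cyc _ setT) ?setCT ?cards0 ?addn0 // perm_onT.
rewrite /labelled in_conn_pairs in_pairs perm_onT.
apply: (iffP idP) => [/andP[/andP[/fpf_involP[_ pI] /eqP cp] /eqP ck]|].
  by split=> // d; have [] := pI d.
case=> pI pF -> ->; rewrite !eqxx !andbT /=; apply/fpf_involP.
by split=> [|d _]; first exact: perm_onT.
Qed.

Definition labelled_map (p : {p | labelled p}) : rooted_map :=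
  let: And4 pI pF cp _ := labelledP _ (valP p) in
  OfDartMap (DartMap ord0 pI pF ((transitive_component _ _).2 cp)).

Lemma labelled_mapE p : exists pI pF pT,
  labelled_map p = OfDartMap (@DartMap I (val p).1 (val p).2 ord0 pI pF pT).
Proof.
rewrite /labelled_map; case: (elimT (labelledP (val p)) (valP p)) => pI pF cp _.
by do 3 eexists.
Qed.

Lemma labelled_map_iso p q : rooted_map_iso (labelled_map p) (labelled_map q) <->
  exists2 g : {perm I}, g ord0 = ord0 &
    val q = ((val p).1 ^ g, (val p).2 ^ g)%g.
Proof.
have [pI [pF [pT ->]]] := labelled_mapE p.
have [qI [qF [qT ->]]] := labelled_mapE q.
split=> /= [[f /= [fb fs fa fr]]|[g g0 qE]].
  pose g := perm (bij_inj fb); have gE x : g x = f x by rewrite permE.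
  exists g; first by rewrite gE.
  rewrite [LHS]surjective_pairing; congr pair; apply/permP => y;
    rewrite -[y](permKV g); move: (g^-1%g y) => x; by rewrite permJ !gE.
exists g; split=> [|d|d|//] /=; first by exists g^-1%g; [exact: permK|exact: permKV].
- by rewrite qE permJ.
- by rewrite qE permJ.
Qed.

Lemma labelled_conj p (g : {perm I}) : labelled p -> g ord0 = ord0 ->
  labelled (p.1 ^ g, p.2 ^ g)%g.
Proof.
move=> /labelledP[pI pF cp cy] g0; apply/labelledP => /=; split.
- by move=> y; rewrite -[y](permKV g) !permJ pI.
- by move=> y; rewrite -[y](permKV g) permJ (inj_eq perm_inj).
- apply/setP => y; rewrite !inE; set q := (_, _).
  suff /subsetP/(_ (g^-1%g y)) : component p ord0 \subset g @^-1: component q ord0.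
    by rewrite cp !inE permKV; apply.
  apply: component_min => [|x]; first by rewrite inE g0 component_id.
  by rewrite !inE => /component_closed /=; rewrite !permJ.
- rewrite -cy; apply/esym/(@card_porbits_conj _ _ g).
    by exists g^-1%g; [exact: permK|exact: permKV].
  by move=> d; rewrite permJ.
Qed.

(** The points where [g] and [h] agree include the root and are stable under both permutations of
    [p], so transitivity makes them all the darts. In particular a rooted map has no nontrivial
    automorphism. *)
Lemma labelled_rigid p (g h : {perm I}) : labelled p ->
  g ord0 = ord0 -> h ord0 = ord0 ->
  (p.1 ^ g = p.1 ^ h)%g -> (p.2 ^ g = p.2 ^ h)%g -> g = h.
Proof.
move=> /labelledP[_ _ cp _] g0 h0 e1 e2; apply/permP => x.
suff /subsetP/(_ x) : component p ord0 \subset [set x | g x == h x].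
  by rewrite cp !inE => /(_ isT)/eqP.
apply: component_min => [|{}x]; first by rewrite inE g0 h0.
rewrite !inE => /eqP gh; split; apply/eqP.
  by rewrite -permJ e1 gh permJ.
by rewrite -permJ e2 gh permJ.
Qed.

(** The permutations fixing [ord0], [N!] in number, act by conjugation; the class is one orbit, and
    the action is free by [labelled_rigid]. *)
Lemma card_class_labelled p :
  #|class_of rooted_map_iso labelled_map (labelled_map p)| = N`!.
Proof.
pose G : {set {perm I}} := [set g | perm_on [set~ ord0] g].
have GP g : (g \in G) = (g ord0 == ord0).
  rewrite inE; apply/idP/eqP => [gG|g0].
    by rewrite (out_perm gG) // !inE eqxx.
  by apply/subsetP => x; rewrite !inE; apply: contraNneq => ->; rewrite g0.
have -> : N`! = #|G|.
  have := card_perm [set~ ord0 : I]; rewrite cardsC1 card_ord /= => <-.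
  by apply: eq_card => g; rewrite !inE.
(* The default value [p] is never taken on [G], by [labelled_conj]. *)
pose c g : {p | labelled p} := insubd p ((val p).1 ^ g, (val p).2 ^ g)%g.
have cE g : g \in G -> val (c g) = ((val p).1 ^ g, (val p).2 ^ g)%g.
  rewrite GP => /eqP g0; rewrite val_insubd.
  by rewrite (labelled_conj (valP p) g0).
rewrite -(card_in_imset (f := c) (D := mem G)); last first.
  move=> g h gG hG /(congr1 val); rewrite !cE // => -[].
  move: gG hG; rewrite !GP => /eqP gG /eqP hG.
  exact: labelled_rigid (valP p) gG hG.
apply: eq_card => q; apply/in_class_of/imsetP => [/labelled_map_iso[g g0 qE]|].
  have gG : g \in G by rewrite GP g0.
  by exists g => //; apply: val_inj; rewrite cE.
case=> g gG ->; apply/labelled_map_iso; exists g; last exact: cE.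
by apply/eqP; rewrite -GP.
Qed.

Lemma dart_map_labelled (M : dart_map) : #|dart M| = N.+1 ->
  #|porbits (sigma M)| = k ->
  exists p, rooted_map_iso (OfDartMap M) (labelled_map p).
Proof.
move=> DN Mk.
pose f0 := cast_ord DN \o enum_rank.
(* An arbitrary numbering of the darts is corrected so that the root gets [ord0]. *)
pose f := tperm (f0 (root M)) ord0 \o f0.
have fb : bijective f.
  apply: bij_comp; first by exists (tperm (f0 (root M)) ord0); exact: tpermK.
  apply: bij_comp; last exact: enum_rank_bij.
  by exists (cast_ord (esym DN)); [exact: cast_ordK|exact: cast_ordKV].
have fr : f (root M) = ord0 by rewrite /f /= tpermL.
have [g fK gK] := fb.
have fI s : injective (f \o (s : {perm dart M}) \o g).
  by apply: inj_comp (can_inj gK); apply: inj_comp (can_inj fK) perm_inj.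
pose p := (perm (fI (sigma M)), perm (fI (alpha M))).
have ps d : f (sigma M d) = p.1 (f d) by rewrite permE /= fK.
have pa d : f (alpha M d) = p.2 (f d) by rewrite permE /= fK.
have pL : labelled p.
  apply/labelledP; split.
  - by move=> y; rewrite -[y]gK -!pa alpha_involutive.
  - by move=> y; rewrite -[y]gK -pa (inj_eq (can_inj fK)) alpha_fixfree.
  - apply/setP => y; rewrite !inE.
    suff /subsetP/(_ (g y)) :
        component (sigma M, alpha M) (root M) \subset f @^-1: component p ord0.
      have /= -> := (transitive_component (sigma M, alpha M) (root M)).1
        (map_transitive M).
      by rewrite !inE gK; apply.
    apply: component_min => [|x]; first by rewrite inE fr component_id.
    by rewrite !inE => /component_closed; rewrite -ps -pa.
  - by rewrite -Mk; apply/esym/(card_porbits_conj fb).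
exists (Sub p pL); have [pI [pF [pT ->]]] := labelled_mapE (Sub p pL).
by exists f; split=> //=; rewrite SubK.
Qed.

Lemma card_labelled : (#|{: {p | labelled p}}|%:R = (conn_poly N)`_k)%R.
Proof.
have := @sum_conn_pairs I setT ord0 (in_setT _).
rewrite cardsT card_ord /= => <-.
rewrite coef_sum card_sig -sum1_card natr_sum.
rewrite [RHS](bigID (fun p => cyc setT p.1 == k)) /=.
rewrite [X in (_ = _ + X)%R]big1 ?addr0 => [|p /andP[_ pk]]; last first.
  by rewrite coefXn eq_sym (negPf pk).
apply: eq_big => p; first by [].
by case/andP=> _ /eqP <-; rewrite coefXn eqxx.
Qed.
End Labelled.

(** * Counting rooted maps by edges and vertices *)

Lemma rooted_map0_nb_classes k :
  has_nb_classes (rooted_map_with 0 k) rooted_map_iso (k == 1).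
Proof.
have P0 M : rooted_map_with 0 k M -> M = VertexMap /\ k = 1.
  case: M => [|M] [] //= /eqP; rewrite cards_eq0 => /eqP M0.
  (* The root lies on an edge, so only [VertexMap] has none. *)
  have : porbit (alpha M) (root M) \in porbits (alpha M) by apply: imset_f.
  by rewrite M0 inE.
have -> : (k == 1 : nat) = size (nseq (k == 1) tt) by rewrite size_nseq.
apply: (@has_nb_classes_seq _ _ _ _ _ (fun _ => tt)).
- by case: eqP.
- by move=> M /P0[_ ->].
- by case; case: eqP => // -> _; exists VertexMap.
- by move=> M M' /P0[-> _] /P0[-> _].
Qed.

Lemma rooted_map_nb_classes n k : has_nb_classes (rooted_map_with n k)
  rooted_map_iso (count (fun s => leaves s == k) (skeletons n)).
Proof.
case: n => [|n].
  by have := rooted_map0_nb_classes k; rewrite /= addn0 eq_sym.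
(* The 2(n+1) darts are labelled by ['I_N.+1]; with the root at [ord0], each map has [N!]
   labellings. *)
pose N := n.*2.+1.
have [||m mP mN] := @has_nb_classes_uniform _ _ (rooted_map_with n.+1 k) _
    (@labelled_map N k) N`! rooted_map_iso_refl rooted_map_iso_sym
    rooted_map_iso_trans _ _ (@card_class_labelled N k).
- move=> p; have [pI [pF [pT ->]]] := labelled_mapE p.
  have /labelledP[_ _ _ pk] := valP p.
  split=> //=; apply: double_inj; rewrite -(card_fpf_porbits pI pF).
  by rewrite card_ord doubleS.
- case=> [[]|M [/= Mn Mk]] //; apply: dart_map_labelled Mk.
  rewrite (card_fpf_porbits (@alpha_involutive M) (@alpha_fixfree M)) Mn.
  exact: doubleS.
suff <- : m = count (fun s => leaves s == k) (skeletons n.+1) by [].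
(* Both numbers, multiplied by [N!], equal the coefficient of degree [k] of [conn_poly N]. *)
apply/eqP; rewrite -(eqn_pmul2r (fact_gt0 N)) mN -(eqr_nat rat) card_labelled.
rewrite /conn_poly /N /= odd_double /= doubleK mulr_natl coefMn coef_skel_poly.
by rewrite natrM mulr_natr.
Qed.

Theorem mainTheorem2 (n k : nat) :
  [/\ finitely_many_classes (neutral_linear n k) term_iso,
      finitely_many_classes (rooted_map_with n k) rooted_map_iso
    & L_B n k = ((nb_classes (rooted_map_with n k) rooted_map_iso)%:R)%R].
Proof.
have tP := neutral_linear_nb_classes n k.
have mP := rooted_map_nb_classes n k.
split; [by eexists; apply: tP|by eexists; apply: mP|].
rewrite /L_B /b (nb_classesE term_iso_sym term_iso_trans tP).
rewrite (nb_classesE rooted_map_iso_sym rooted_map_iso_trans mP).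
by rewrite natrM mulfK // pnatr_eq0 -lt0n fact_gt0.
Qed.
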